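(* The class $\mathcal{S}^*_{car}$ satisfies the following: (i) $\mathcal{S}^*_{car}\subset\mathcal{S}^*(\alpha)$ for $0\le\alpha\le 1/4$; (ii) $\mathcal{S}^*_{car}\subset\mathcal{SS}^*(\beta)$ for $\beta_0\le\beta\le 1$, where $\beta_0=(2/\pi)\tan^{-1}(3\sqrt{3/5})$; (iii) $k\text{-}\mathcal{S}^*\subset\mathcal{S}^*_{car}$ for $k\ge 5/3$; (iv) $\mathcal{S}^*_e(\alpha)\subset\mathcal{S}^*_{car}$ for $\alpha_0\le\alpha<1$, where $\alpha_0=(e-2)/(2(e-1))$; (v) $\mathcal{S}^*_L(\alpha)\subset\mathcal{S}^*_{car}$ for $1/2\le\alpha<1$; (vi) $\mathcal{S}^*(\sqrt{1+cz})\subset\mathcal{S}^*_{car}$ for $0<c\le 3/4$; (vii) $\mathcal{S}^*[A,B]\subset\mathcal{S}^*_{car}$, where $-1<B<A\le 1$, if one of the following holds: (a) $1-B^2<2(1-AB)\le 3(1-B^2)$ and $2A\le 1+B$; (b) $3(1-B^2)\le 2(1-AB)<5(1-B^2)$ and $2A\le 3+5B$; (viii) $\mathcal{S}^*_{car}\subset\mathcal{S}^*[1,-(M-1)/M]$ for $M\ge(3+\sqrt5)/4$.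
   Context: $\mathbb{D}=\{z:|z|<1\}$; $\mathcal{A}$ is the class of analytic $f$ on $\mathbb{D}$ with $f(0)=0$, $f'(0)=1$. $F\prec G$ means $F=G\circ w$ for an analytic $w:\mathbb{D}\to\mathbb{D}$ with $w(0)=0$. For an analytic $\varphi$ on $\mathbb{D}$, $\mathcal{S}^*(\varphi)$ denotes the class of $f\in\mathcal{A}$ with $zf'(z)/f(z)\prec\varphi(z)$ in $\mathbb{D}$. Square roots and powers are principal branches. Classes: $\mathcal{S}^*_{car}=\mathcal{S}^*(1+z+z^2/2)$; $\mathcal{S}^*(\alpha)$ is the class of $f\in\mathcal{A}$ with $\operatorname{Re}(zf'(z)/f(z))>\alpha$ on $\mathbb{D}$; $\mathcal{SS}^*(\beta)=\mathcal{S}^*(((1+z)/(1-z))^\beta)$, i.e. $f\in\mathcal{A}$ with $|\arg(zf'(z)/f(z))|<\beta\pi/2$; for $k\ge0$, $k\text{-}\mathcal{S}^*$ is the class of $f\in\mathcal{A}$ with $\operatorname{Re}(zf'(z)/f(z))>k|zf'(z)/f(z)-1|$ on $\mathbb{D}$; $\mathcal{S}^*_e(\alpha)=\mathcal{S}^*(\alpha+(1-\alpha)e^z)$ and $\mathcal{S}^*_L(\alpha)=\mathcal{S}^*(\alpha+(1-\alpha)\sqrt{1+z})$ for $0\le\alpha<1$; $\mathcal{S}^*(\sqrt{1+cz})$ for $0<c\le1$; for $-1\le B<A\le1$, $\mathcal{S}^*[A,B]=\mathcal{S}^*((1+Az)/(1+Bz))$. *)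

(* Defs.v *)
From Stdlib Require Import Reals.
From Coquelicot Require Export Coquelicot.
Open Scope R_scope.

Definition Cexp (z : C) : C :=
  (exp (Re z) * cos (Im z), exp (Re z) * sin (Im z)).

(* principal argument, with values in (-PI, PI]; Carg 0 = 0 (irrelevant) *)
Definition Carg (z : C) : R :=
  let x := Re z in let y := Im z in
  if Rlt_dec 0 x then atan (y / x)
  else if Rlt_dec x 0 then
         (if Rle_dec 0 y then atan (y / x) + PI else atan (y / x) - PI)
  else if Rlt_dec 0 y then PI / 2
  else if Rlt_dec y 0 then - (PI / 2)
  else 0.

Definition Clog (z : C) : C := (ln (Cmod z), Carg z).

Definition Cpowr (z : C) (b : R) : C :=
  if Ceq_dec z 0 then 0%C else Cexp (RtoC b * Clog z)%C.

(* principal square root: Re >= 0, and Im >= 0 when Re = 0 *)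
Definition Csqrt (z : C) : C :=
  (sqrt ((Cmod z + Re z) / 2),
   (if Rle_dec 0 (Im z) then 1 else -1) * sqrt ((Cmod z - Re z) / 2)).

Definition inD (z : C) : Prop := Cmod z < 1.

Definition analytic_on_D (f : C -> C) : Prop :=
  forall z : C, inD z -> ex_derive f z.

Definition classA (f : C -> C) : Prop :=
  analytic_on_D f /\ f 0%C = 0%C /\ is_derive (f : C -> C) (RtoC 0 : C_AbsRing) (RtoC 1 : C_NormedModule).

Definition subord (F G : C -> C) : Prop :=
  exists w : C -> C,
    analytic_on_D w /\ (forall z, inD z -> inD (w z)) /\ w 0%C = 0%C /\
    (forall z, inD z -> F z = G (w z)).

(* z f'(z) / f(z), extended by its limit value 1 at z = 0 *)
Definition zfpf (f : C -> C) (z : C) : C :=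
  if Ceq_dec z 0 then 1%C else (z * C_derive f z / f z)%C.

(* f in A with z f'/f well defined (f nonvanishing on D \ {0}) *)
Definition starlike_base (f : C -> C) : Prop :=
  classA f /\ (forall z, inD z -> z <> 0%C -> f z <> 0%C).

Definition Sstar (phi : C -> C) (f : C -> C) : Prop :=
  starlike_base f /\ subord (zfpf f) phi.

Definition phi_car (w : C) : C := (1 + w + w * w / 2)%C.
Definition Scar := Sstar phi_car.

Definition Sstar_order (alpha : R) (f : C -> C) : Prop :=
  starlike_base f /\ (forall z, inD z -> Re (zfpf f z) > alpha).

Definition phi_SS (beta : R) (w : C) : C := Cpowr ((1 + w) / (1 - w))%C beta.
Definition SSstar (beta : R) := Sstar (phi_SS beta).

Definition kSstar (k : R) (f : C -> C) : Prop :=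
  starlike_base f /\
  (forall z, inD z -> Re (zfpf f z) > k * Cmod (zfpf f z - 1)%C).

Definition phi_e (alpha : R) (w : C) : C :=
  (RtoC alpha + RtoC (1 - alpha) * Cexp w)%C.
Definition Sstar_e (alpha : R) := Sstar (phi_e alpha).

Definition phi_L (alpha : R) (w : C) : C :=
  (RtoC alpha + RtoC (1 - alpha) * Csqrt (1 + w))%C.
Definition Sstar_L (alpha : R) := Sstar (phi_L alpha).

Definition phi_sqrt (c : R) (w : C) : C := Csqrt (1 + RtoC c * w)%C.
Definition Sstar_sqrt (c : R) := Sstar (phi_sqrt c).

Definition phi_AB (A B : R) (w : C) : C :=
  ((1 + RtoC A * w) / (1 + RtoC B * w))%C.
Definition Sstar_AB (A B : R) := Sstar (phi_AB A B).

Definition beta0 : R := (2 / PI) * atan (3 * sqrt (3 / 5)).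
Definition alpha0 : R := (exp 1 - 2) / (2 * (exp 1 - 1)).

(* Main.v *)
Require Import Defs.
From Stdlib Require Import Reals.
From Stdlib Require Import Lra Psatz ClassicalEpsilon FunctionalExtensionality.
From Coquelicot Require Import Coquelicot.
Open Scope R_scope.

(** Since 2 (1 + w + w^2/2) - 1 = (1 + w)^2, a value F lies in phi_car(D) iff G = 2F - 1 is the
square of a point of the disc |s - 1| < 1, i.e. iff |G|^2 < 2|G| + 2 Re G (a cardioid), and then w =
sqrt(2F - 1) - 1 depends analytically on F. Hence a class generated by psi is contained in S*_car as
soon as 2 psi(D) - 1 lies in the cardioid, and the converse inclusions follow by inverting the
target function on phi_car(D) in the same way. What remains are inequalities in the plane.

For k-S*, the Schwarz function must be built from z f'/f itself, so one needs that f' is again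
complex differentiable: Goursat's theorem for rectangles yields Cauchy's formula on squares, and
Cauchy integrals can be differentiated repeatedly. *)

(** * Complex differentiation *)

(** The bounds on the parameters come from the two real boundary points of phi_car(D). At
    phi_car(-1) = 1/2 the cardioid has its cusp, G = 0; the value 1/2 in (v), the value 3/4 in (vi)
    and [alpha0] in (iv) are exactly those for which psi(-1) = 1/2. At phi_car(1) = 5/2, that is G =
    4, the ellipse Re F = (5/3) |F - 1| of (iii) touches from inside, and the diameters of the discs
    in (vii) must fit between 1/2 and 5/2. In (ii) and (viii) the extremal curve instead touches at
    non-real points; there a polynomial in Re w acquires a double root, and the proof exhibits the
    square. As the closures touch, no inequality has slack at the extremal parameter: strictness
    always comes from |w| < 1 or from the open condition defining the class. *)

(* [C_NormedModule] carries the product uniform structure, [C_AbsRing] the one of [Cmod];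
   differentiability is the same but not convertible, so the calculus is done in the latter and
   transported once. *)
Definition cder (f : C -> C) (z l : C) : Prop :=
  @is_derive C_AbsRing (AbsRing_NormedModule C_AbsRing) f z l.

Definition holo (f : C -> C) (z : C) : Prop := exists l, cder f z l.

Definition ccont (f : C -> C) (z : C) : Prop :=
  forall eps, 0 < eps -> exists delta, 0 < delta /\
    forall y, Cmod (y - z) < delta -> Cmod (f y - f z) < eps.

Lemma cder_eps (f : C -> C) (z l : C) :
  cder f z l <-> forall eps, 0 < eps -> exists delta, 0 < delta /\
    forall y, Cmod (y - z) < delta ->
      Cmod (f y - f z - l * (y - z)) <= eps * Cmod (y - z).
Proof.
  split.
  - intros [_ H] eps Heps.
    destruct (H z (fun P HP => HP) (mkposreal eps Heps)) as [d Hd].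
    exists d; split; [apply cond_pos|].
    intros y Hy. specialize (Hd y Hy).
    replace (l * (y - z))%C with ((y - z) * l)%C by ring. exact Hd.
  - intros H. split.
    + apply (is_linear_scal_l (K := C_AbsRing) (V := AbsRing_NormedModule C_AbsRing) l).
    + intros x Hx eps.
      apply (is_filter_lim_locally_unique (V := AbsRing_NormedModule C_AbsRing) z x) in Hx. subst x.
      destruct (H eps (cond_pos eps)) as [d [Hd HH]].
      exists (mkposreal d Hd). intros y Hy. specialize (HH y Hy).
      replace (l * (y - z))%C with ((y - z) * l)%C in HH by ring. exact HH.
Qed.

Lemma is_derive_C_cder (f : C -> C) (z l : C) :
  @is_derive C_AbsRing C_NormedModule f z l <-> cder f z l.
Proof.
  rewrite cder_eps. split.
  - intros [_ H] eps Heps.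
    destruct (H z (fun P HP => HP) (mkposreal eps Heps)) as [d Hd].
    exists d; split; [apply cond_pos|].
    intros y Hy. specialize (Hd y Hy).
    replace (l * (y - z))%C with ((y - z) * l)%C by ring. exact Hd.
  - intros H. split.
    + apply (is_linear_scal_l (K := C_AbsRing) (V := C_NormedModule) l).
    + intros x Hx eps.
      apply (is_filter_lim_locally_unique (V := AbsRing_NormedModule C_AbsRing) z x) in Hx. subst x.
      destruct (H eps (cond_pos eps)) as [d [Hd HH]].
      exists (mkposreal d Hd). intros y Hy. specialize (HH y Hy).
      replace (l * (y - z))%C with ((y - z) * l)%C in HH by ring. exact HH.
Qed.

Lemma ex_derive_C_holo (f : C -> C) (z : C) :
  @ex_derive C_AbsRing C_NormedModule f z <-> holo f z.
Proof.
  split; intros [l Hl]; exists l; apply is_derive_C_cder; exact Hl.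
Qed.

Lemma cder_ext_near (f g : C -> C) (z l : C) (r : R) : 0 < r ->
  (forall y, Cmod (y - z) < r -> f y = g y) -> cder f z l -> cder g z l.
Proof.
  intros Hr H Hf. apply (is_derive_ext_loc (K := C_AbsRing) (V := AbsRing_NormedModule C_AbsRing) f g z l); [|exact Hf].
  exists (mkposreal r Hr). exact H.
Qed.

Lemma holo_ext_near (f g : C -> C) (z : C) (r : R) : 0 < r ->
  (forall y, Cmod (y - z) < r -> f y = g y) -> holo f z -> holo g z.
Proof. intros Hr H [l Hl]. exists l. exact (cder_ext_near f g z l r Hr H Hl). Qed.

Lemma cder_unique (f : C -> C) (z l l' : C) : cder f z l -> cder f z l' -> l = l'.
Proof.
  intros H H'. apply is_derive_C_cder in H. apply is_derive_C_cder in H'.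
  rewrite <- (is_C_derive_unique f z l H). apply is_C_derive_unique. exact H'.
Qed.

Lemma holo_C_derive (f : C -> C) (z : C) : holo f z -> cder f z (C_derive f z).
Proof.
  intros [l Hl]. replace (C_derive f z) with l; [exact Hl|].
  symmetry. apply is_C_derive_unique. apply is_derive_C_cder. exact Hl.
Qed.

Lemma cder_ccont (f : C -> C) (z l : C) : cder f z l -> ccont f z.
Proof.
  intros H eps Heps. rewrite cder_eps in H.
  destruct (H 1 Rlt_0_1) as [d [Hd HH]].
  pose proof (Cmod_ge_0 l) as Hl.
  exists (Rmin d (eps / (Cmod l + 2))). split.
  - apply Rmin_glb_lt; [exact Hd|apply Rdiv_lt_0_compat; lra].
  - intros y Hy.
    specialize (HH y (Rlt_le_trans _ _ _ Hy (Rmin_l _ _))).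
    assert (Hy2 := Rlt_le_trans _ _ _ Hy (Rmin_r _ _)).
    replace (f y - f z)%C with ((f y - f z - l * (y - z)) + l * (y - z))%C by ring.
    apply Rle_lt_trans with ((Cmod l + 1) * Cmod (y - z)).
    + eapply Rle_trans; [apply Cmod_triangle|]. rewrite Cmod_mult. lra.
    + pose proof (Cmod_ge_0 (y - z)).
      apply Rmult_lt_compat_l with (r := Cmod l + 2) in Hy2; [|lra].
      replace ((Cmod l + 2) * (eps / (Cmod l + 2))) with eps in Hy2 by (field; lra).
      lra.
Qed.

Lemma holo_ccont (f : C -> C) (z : C) : holo f z -> ccont f z.
Proof. intros [l Hl]. exact (cder_ccont f z l Hl). Qed.

Lemma cder_eq (f : C -> C) (z l l' : C) : cder f z l -> l = l' -> cder f z l'.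
Proof. intros H <-. exact H. Qed.

Lemma cder_const (c z : C) : cder (fun _ => c) z 0%C.
Proof. apply (is_derive_const (K := C_AbsRing) (V := AbsRing_NormedModule C_AbsRing) c z). Qed.

Lemma cder_id (z : C) : cder (fun y => y) z 1%C.
Proof. apply (is_derive_id (K := C_AbsRing) z). Qed.

Lemma cder_plus (f g : C -> C) (z l m : C) : cder f z l -> cder g z m ->
  cder (fun y => f y + g y)%C z (l + m)%C.
Proof. apply (is_derive_plus (K := C_AbsRing) (V := AbsRing_NormedModule C_AbsRing) f g z l m). Qed.

Lemma cder_minus (f g : C -> C) (z l m : C) : cder f z l -> cder g z m ->
  cder (fun y => f y - g y)%C z (l - m)%C.
Proof. apply (is_derive_minus (K := C_AbsRing) (V := AbsRing_NormedModule C_AbsRing) f g z l m). Qed.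

Lemma cder_mult (f g : C -> C) (z l m : C) : cder f z l -> cder g z m ->
  cder (fun y => f y * g y)%C z (l * g z + f z * m)%C.
Proof.
  intros Hf Hg. apply (is_derive_mult (K := C_AbsRing) f g z l m Hf Hg).
  exact Cmult_comm.
Qed.

Lemma cder_comp (f g : C -> C) (z l m : C) : cder f (g z) l -> cder g z m ->
  cder (fun y => f (g y)) z (m * l)%C.
Proof. apply (is_derive_comp (K := C_AbsRing) (V := AbsRing_NormedModule C_AbsRing) f g z l m). Qed.

Lemma Cmod_minus_sym (x y : C) : Cmod (x - y) = Cmod (y - x).
Proof. rewrite <- Cmod_opp. f_equal. ring. Qed.

Lemma Cmod_ge_minus (x y : C) : Cmod x - Cmod (x - y) <= Cmod y.
Proof.
  assert (H := Cmod_triangle (x - y) y).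
  replace (x - y + y)%C with x in H by ring. lra.
Qed.

(** The error of the linear approximation is exactly (y - z)^2 / (y z^2), and |y| >= |z|/2 near
    z. *)
Lemma cder_inv (z : C) : z <> 0%C -> cder Cinv z (- / (z * z))%C.
Proof.
  intros Hz. apply cder_eps. intros eps Heps.
  assert (Hm := proj1 (Cmod_gt_0 z) Hz).
  assert (Hm3 : 0 < Cmod z ^ 3) by (apply pow_lt; lra).
  exists (Rmin (Cmod z / 2) (eps * Cmod z ^ 3 / 2)). split.
  - apply Rmin_glb_lt; [lra|]. apply Rdiv_lt_0_compat; [apply Rmult_lt_0_compat|]; lra.
  - intros y Hy.
    assert (H1 := Rlt_le_trans _ _ _ Hy (Rmin_l _ _)).
    assert (H2 := Rlt_le_trans _ _ _ Hy (Rmin_r _ _)).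
    assert (Hyz := Cmod_ge_minus z y). rewrite Cmod_minus_sym in Hyz.
    assert (Hy0 : y <> 0%C) by (apply Cmod_gt_0; lra).
    replace (/ y - / z - - / (z * z) * (y - z))%C
      with ((y - z) * (y - z) / (y * (z * z)))%C by (field; split; assumption).
    rewrite Cmod_div by (repeat apply Cmult_neq_0; assumption).
    rewrite !Cmod_mult.
    set (d := Cmod (y - z)) in *. set (a := Cmod y) in *. set (b := Cmod z) in *.
    assert (Hd : 0 <= d) by apply Cmod_ge_0.
    assert (Hab : 0 < a * (b * b)) by (repeat apply Rmult_lt_0_compat; lra).
    apply Rmult_le_reg_r with (a * (b * b)); [exact Hab|].
    replace (d * d / (a * (b * b)) * (a * (b * b))) with (d * d) by (field; lra).
    rewrite (Rmult_comm eps d), !Rmult_assoc.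
    apply Rmult_le_compat_l; [exact Hd|].
    assert (b / 2 * (b * b) <= a * (b * b)) by (apply Rmult_le_compat_r; [nra|lra]).
    assert (eps * (b / 2 * (b * b)) <= eps * (a * (b * b)))
      by (apply Rmult_le_compat_l; lra).
    simpl in H2. lra.
Qed.

Lemma holo_const (c z : C) : holo (fun _ => c) z.
Proof. eexists; apply cder_const. Qed.
Lemma holo_id (z : C) : holo (fun y => y) z.
Proof. eexists; apply cder_id. Qed.
Lemma holo_plus (f g : C -> C) (z : C) : holo f z -> holo g z -> holo (fun y => f y + g y)%C z.
Proof. intros [l Hl] [m Hm]. eexists; apply cder_plus; eassumption. Qed.
Lemma holo_minus (f g : C -> C) (z : C) : holo f z -> holo g z -> holo (fun y => f y - g y)%C z.
Proof. intros [l Hl] [m Hm]. eexists; apply cder_minus; eassumption. Qed.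
Lemma holo_mult (f g : C -> C) (z : C) : holo f z -> holo g z -> holo (fun y => f y * g y)%C z.
Proof. intros [l Hl] [m Hm]. eexists; apply cder_mult; eassumption. Qed.
Lemma holo_comp (f g : C -> C) (z : C) : holo f (g z) -> holo g z -> holo (fun y => f (g y)) z.
Proof. intros [l Hl] [m Hm]. eexists; apply cder_comp; eassumption. Qed.
Lemma holo_inv (f : C -> C) (z : C) : holo f z -> f z <> 0%C -> holo (fun y => / f y)%C z.
Proof. intros Hf H0. apply (holo_comp Cinv f); [eexists; apply cder_inv|]; assumption. Qed.
Lemma holo_div (f g : C -> C) (z : C) :
  holo f z -> holo g z -> g z <> 0%C -> holo (fun y => f y / g y)%C z.
Proof. intros Hf Hg H0. apply holo_mult; [|apply holo_inv]; assumption. Qed.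

(** A continuous local right inverse of a differentiable map with nonzero derivative is
    differentiable. This yields the derivatives of [Csqrt] and [Clog] from those of the square and
    [Cexp], without the Cauchy-Riemann equations. *)
Lemma cder_inverse (g h : C -> C) (z l : C) (r : R) : 0 < r ->
  (forall y, Cmod (y - z) < r -> h (g y) = y) ->
  ccont g z -> cder h (g z) l -> l <> 0%C -> cder g z (/ l)%C.
Proof.
  intros Hr Hinv Hc Hh Hl. apply cder_eps. intros eps Heps.
  rewrite cder_eps in Hh.
  assert (Hm := proj1 (Cmod_gt_0 l) Hl). set (b := Cmod l) in *.
  (* The bound b/2 turns an error relative to |g y - g z| into one relative to |y - z|, since then b
     |g y - g z| <= 2 |y - z|. The other bound makes the resulting error at most eps |y - z| after
     division by l. *)
  set (e := Rmin (b / 2) (eps * (b * b) / 2)).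
  assert (Hbb : 0 < b * b) by nra.
  assert (He : 0 < e).
  { apply Rmin_glb_lt; [lra|]. apply Rdiv_lt_0_compat; [apply Rmult_lt_0_compat|]; lra. }
  assert (He1 : e <= b / 2) by apply Rmin_l.
  assert (He2 : e <= eps * (b * b) / 2) by apply Rmin_r.
  destruct (Hh e He) as [d1 [Hd1 H1]].
  destruct (Hc d1 Hd1) as [d2 [Hd2 H2]].
  exists (Rmin r d2). split; [apply Rmin_glb_lt; assumption|].
  intros y Hy.
  assert (Hyr := Rlt_le_trans _ _ _ Hy (Rmin_l _ _)).
  assert (Hy2 := Rlt_le_trans _ _ _ Hy (Rmin_r _ _)).
  specialize (H1 (g y) (H2 y Hy2)).
  rewrite (Hinv y Hyr), (Hinv z) in H1
    by (replace (z - z)%C with (RtoC 0) by ring; rewrite Cmod_0; exact Hr).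
  set (E := (y - z - l * (g y - g z))%C) in *.
  replace (g y - g z - / l * (y - z))%C with (- (E / l))%C by (unfold E; field; exact Hl).
  rewrite Cmod_opp, Cmod_div by exact Hl. fold b.
  set (D := Cmod (g y - g z)) in *. set (d := Cmod (y - z)) in *.
  assert (HD : b * D <= d + e * D).
  { unfold b, D. rewrite <- Cmod_mult.
    replace (l * (g y - g z))%C with ((y - z) + - E)%C by (unfold E; ring).
    eapply Rle_trans; [apply Cmod_triangle|]. rewrite Cmod_opp. fold D d. lra. }
  assert (HD0 : 0 <= D) by apply Cmod_ge_0.
  assert (Hd0 : 0 <= d) by apply Cmod_ge_0.
  assert (HD2 : b * D <= 2 * d) by nra.
  apply Rmult_le_reg_r with b; [exact Hm|].
  unfold Rdiv. rewrite Rmult_assoc, Rinv_l, Rmult_1_r by lra.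
  apply Rle_trans with (e * D); [exact H1|].
  apply Rle_trans with (eps * (b * b) / 2 * D); [apply Rmult_le_compat_r; assumption|].
  assert (eps * b * (b * D) <= eps * b * (2 * d)) by (apply Rmult_le_compat_l; nra).
  lra.
Qed.

(** * Square root, exponential and logarithm *)

Lemma Cmod_sqr (z : C) : Cmod z * Cmod z = Re z * Re z + Im z * Im z.
Proof.
  assert (H := Cmod2_alt z). simpl in H. lra.
Qed.

Lemma Cmod_le_abs (z : C) : Cmod z <= Rabs (Re z) + Rabs (Im z).
Proof.
  assert (H := Cmod_sqr z).
  assert (H1 := Rabs_pos (Re z)). assert (H2 := Rabs_pos (Im z)).
  assert (H3 := Rsqr_abs (Re z)). assert (H4 := Rsqr_abs (Im z)). unfold Rsqr in *.
  assert (H5 := Cmod_ge_0 z). nra.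
Qed.

Lemma im_le_Cmod (z : C) : Rabs (Im z) <= Cmod z.
Proof. eapply Rle_trans; [apply Rmax_r|apply Rmax_Cmod]. Qed.

Lemma Re_le_Cmod (z : C) : Re z <= Cmod z.
Proof. eapply Rle_trans; [apply Rle_abs|apply re_le_Cmod]. Qed.

Lemma Re_ge_opp_Cmod (z : C) : - Cmod z <= Re z.
Proof.
  assert (H := re_le_Cmod z). apply Rabs_le_between in H. lra.
Qed.

Lemma C_ext (x y : C) : Re x = Re y -> Im x = Im y -> x = y.
Proof. destruct x, y; simpl; intros; subst; reflexivity. Qed.

(** The squares of the two components differ by Re z, and their product is |Im z|/2 up to sign
    because |z|^2 - (Re z)^2 = (Im z)^2; the sign chosen in [Csqrt] restores Im z. *)
Lemma Csqrt_sqr (z : C) : (Csqrt z * Csqrt z)%C = z.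
Proof.
  assert (H1 := Re_le_Cmod z). assert (H2 := Re_ge_opp_Cmod z).
  assert (H3 := Cmod_sqr z).
  assert (Hp : 0 <= (Cmod z + Re z) / 2) by lra.
  assert (Hm : 0 <= (Cmod z - Re z) / 2) by lra.
  assert (Hsp := sqrt_sqrt _ Hp). assert (Hsm := sqrt_sqrt _ Hm).
  assert (Hprod : sqrt ((Cmod z + Re z) / 2) * sqrt ((Cmod z - Re z) / 2) = Rabs (Im z) / 2).
  { rewrite <- sqrt_mult by assumption.
    replace ((Cmod z + Re z) / 2 * ((Cmod z - Re z) / 2)) with ((Im z / 2) * (Im z / 2)).
    - replace ((Im z / 2) * (Im z / 2)) with (Rsqr (Im z / 2)) by reflexivity.
      rewrite sqrt_Rsqr_abs. unfold Rdiv. rewrite Rabs_mult, (Rabs_right (/ 2)) by lra.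
      reflexivity.
    - assert (E : 4 * (Im z / 2 * (Im z / 2)) =
        4 * ((Cmod z + Re z) / 2 * ((Cmod z - Re z) / 2))) by (field_simplify; nra).
      lra. }
  apply C_ext; unfold Csqrt; simpl.
  - destruct (Rle_dec 0 (Im z)); nra.
  - destruct (Rle_dec 0 (Im z)) as [Hi|Hi].
    + rewrite Rabs_right in Hprod by lra. nra.
    + rewrite Rabs_left in Hprod by lra. nra.
Qed.

Lemma Csqrt_Re_ge (z : C) : 0 <= Re (Csqrt z).
Proof. apply sqrt_pos. Qed.

Lemma Cmod_Csqrt (z : C) : Cmod (Csqrt z) * Cmod (Csqrt z) = Cmod z.
Proof. rewrite <- Cmod_mult, Csqrt_sqr. reflexivity. Qed.

Lemma Re_Csqrt_sqr (z : C) : Re (Csqrt z) * Re (Csqrt z) = (Cmod z + Re z) / 2.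
Proof. apply sqrt_sqrt. assert (H := Re_ge_opp_Cmod z). lra. Qed.

(** The hypothesis says that z avoids the slit of nonpositive reals. *)
Lemma Csqrt_Re_pos (z : C) : 0 < Cmod z + Re z -> 0 < Re (Csqrt z).
Proof. intros H. apply sqrt_lt_R0. lra. Qed.

(** In (Csqrt z - s)(Csqrt z + s) = 0 the second factor has positive real part. *)
Lemma Csqrt_unique (z s : C) : 0 < Re s -> (s * s)%C = z -> Csqrt z = s.
Proof.
  intros Hs Hz.
  assert (H : ((Csqrt z - s) * (Csqrt z + s))%C = 0%C).
  { replace ((Csqrt z - s) * (Csqrt z + s))%C with (Csqrt z * Csqrt z - s * s)%C by ring.
    rewrite Csqrt_sqr, Hz. ring. }
  destruct (Ceq_dec (Csqrt z - s)%C 0) as [E|E].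
  - apply Ceq_minus. exact E.
  - exfalso. assert (E2 : (Csqrt z + s)%C <> 0%C).
    { intros E2. assert (E3 : Re (Csqrt z + s)%C = 0) by (rewrite E2; reflexivity).
      rewrite re_plus in E3. assert (H4 := Csqrt_Re_ge z). lra. }
    exact (Cmult_neq_0 _ _ E E2 H).
Qed.

Lemma Csqrt_1 : Csqrt 1 = 1%C.
Proof. apply Csqrt_unique; [simpl; lra|ring]. Qed.

(* [|sqrt y - sqrt z| |sqrt y + sqrt z| = |y - z|], and the second factor is at least [Re (sqrt z)]. *)
Lemma Csqrt_ccont (z : C) : 0 < Cmod z + Re z -> ccont Csqrt z.
Proof.
  intros Hz. assert (Hs := Csqrt_Re_pos z Hz). intros eps Heps.
  exists (eps * Re (Csqrt z)). split; [apply Rmult_lt_0_compat; assumption|].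
  intros y Hy.
  replace (y - z)%C with ((Csqrt y - Csqrt z) * (Csqrt y + Csqrt z))%C in Hy.
  2:{ transitivity (Csqrt y * Csqrt y - Csqrt z * Csqrt z)%C; [ring|].
      rewrite !Csqrt_sqr. reflexivity. }
  rewrite Cmod_mult in Hy.
  assert (H1 := Re_le_Cmod (Csqrt y + Csqrt z)). rewrite re_plus in H1.
  assert (H2 := Csqrt_Re_ge y).
  assert (H3 := Cmod_ge_0 (Csqrt y - Csqrt z)).
  nra.
Qed.

Lemma Csqrt_holo (z : C) : 0 < Cmod z + Re z -> holo Csqrt z.
Proof.
  intros Hz. assert (Hs := Csqrt_Re_pos z Hz).
  eexists. eapply (cder_inverse Csqrt (fun y => y * y)%C z _ 1 Rlt_0_1).
  - intros y _. apply Csqrt_sqr.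
  - apply Csqrt_ccont. exact Hz.
  - apply cder_mult; apply cder_id.
  - intros E. replace (1 * Csqrt z + Csqrt z * 1)%C with (2 * Csqrt z)%C in E by ring.
    apply (f_equal Re) in E. rewrite re_scal_l in E. change (Re 0) with 0 in E. lra.
Qed.

Lemma Cexp_plus (x y : C) : Cexp (x + y) = (Cexp x * Cexp y)%C.
Proof.
  apply C_ext; unfold Cexp; rewrite re_plus, im_plus, exp_plus; simpl.
  - rewrite cos_plus. ring.
  - rewrite sin_plus. ring.
Qed.

Lemma Cexp_0 : Cexp 0 = 1%C.
Proof. apply C_ext; unfold Cexp; simpl; rewrite exp_0, ?cos_0, ?sin_0; ring. Qed.

Lemma Cmod_Cexp (z : C) : Cmod (Cexp z) = exp (Re z).
Proof.
  assert (H := Cmod_sqr (Cexp z)). unfold Cexp in H at 3 4 5 6; simpl in H.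
  assert (H2 := sin2_cos2 (Im z)). unfold Rsqr in H2.
  assert (H3 := exp_pos (Re z)). assert (H4 := Cmod_ge_0 (Cexp z)).
  apply Rsqr_inj; [lra|lra|]. unfold Rsqr. rewrite H.
  transitivity (exp (Re z) * exp (Re z) * (sin (Im z) * sin (Im z) + cos (Im z) * cos (Im z))); [ring|].
  rewrite H2. ring.
Qed.

Lemma Cexp_nz (z : C) : Cexp z <> 0%C.
Proof. apply Cmod_gt_0. rewrite Cmod_Cexp. apply exp_pos. Qed.

Lemma derivable_eps_0 (f : R -> R) (l : R) : derivable_pt_lim f 0 l ->
  forall eps, 0 < eps -> exists delta, 0 < delta /\
    forall h, Rabs h < delta -> Rabs (f h - f 0 - l * h) <= eps * Rabs h.
Proof.
  intros H eps Heps. destruct (H eps Heps) as [d Hd].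
  exists d; split; [apply cond_pos|]. intros h Hh.
  destruct (Req_dec h 0) as [E|E].
  - subst h. replace (f 0 - f 0 - l * 0) with 0 by ring. rewrite Rabs_R0. lra.
  - specialize (Hd h E Hh). rewrite Rplus_0_l in Hd.
    replace (f h - f 0 - l * h) with (((f h - f 0) / h - l) * h) by (field; exact E).
    rewrite Rabs_mult. apply Rmult_le_compat_r; [apply Rabs_pos|lra].
Qed.

Lemma Cexp_cder_0 : cder Cexp 0 1.
Proof.
  apply cder_eps. intros eps Heps.
  (* The errors of the real and imaginary parts add up to at most (4 + 5) e |z|. The bound e <= 1
     keeps exp (Re z) <= 3, and |z| < e makes the mixed term (Re z)(Im z) of second order. *)
  set (e := Rmin 1 (eps / 10)).
  assert (He : 0 < e) by (apply Rmin_glb_lt; lra).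
  assert (He1 : e <= 1) by apply Rmin_l. assert (He2 : e <= eps / 10) by apply Rmin_r.
  destruct (derivable_eps_0 exp 1) with (eps := e) as [d1 [Hd1 H1]]; [|exact He|].
  { replace 1 with (exp 0) by apply exp_0. apply derivable_pt_lim_exp. }
  destruct (derivable_eps_0 sin 1) with (eps := e) as [d2 [Hd2 H2]]; [|exact He|].
  { replace 1 with (cos 0) by apply cos_0. apply derivable_pt_lim_sin. }
  destruct (derivable_eps_0 cos 0) with (eps := e) as [d3 [Hd3 H3]]; [|exact He|].
  { replace 0 with (- sin 0) at 2 by (rewrite sin_0; ring). apply derivable_pt_lim_cos. }
  exists (Rmin (Rmin d1 d2) (Rmin d3 e)). split; [apply Rmin_glb_lt; apply Rmin_glb_lt; assumption|].
  intros z Hz. replace (z - 0)%C with z in * by ring.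
  assert (B1 : Cmod z < d1) by (eapply Rlt_le_trans; [exact Hz|]; eapply Rle_trans; apply Rmin_l).
  assert (B2 : Cmod z < d2)
    by (eapply Rlt_le_trans; [exact Hz|]; eapply Rle_trans; [apply Rmin_l|apply Rmin_r]).
  assert (B3 : Cmod z < d3)
    by (eapply Rlt_le_trans; [exact Hz|]; eapply Rle_trans; [apply Rmin_r|apply Rmin_l]).
  assert (B4 : Cmod z < e) by (eapply Rlt_le_trans; [exact Hz|]; eapply Rle_trans; apply Rmin_r).
  assert (Hx := re_le_Cmod z). assert (Hy := im_le_Cmod z).
  specialize (H1 (Re z) ltac:(lra)). specialize (H2 (Im z) ltac:(lra)).
  specialize (H3 (Im z) ltac:(lra)).
  rewrite exp_0 in H1. rewrite sin_0 in H2. rewrite cos_0 in H3. rewrite Cexp_0.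
  set (x := Re z) in *. set (y := Im z) in *.
  set (m := Cmod z) in *.
  assert (Hm : 0 <= m) by apply Cmod_ge_0.
  set (a := exp x - 1 - 1 * x) in *. set (b := sin y - 0 - 1 * y) in *.
  set (c := cos y - 1 - 0 * y) in *.
  assert (Ha : Rabs a <= e * m) by (eapply Rle_trans; [exact H1|]; apply Rmult_le_compat_l; lra).
  assert (Hb : Rabs b <= e * m) by (eapply Rle_trans; [exact H2|]; apply Rmult_le_compat_l; lra).
  assert (Hc : Rabs c <= e * m) by (eapply Rle_trans; [exact H3|]; apply Rmult_le_compat_l; lra).
  assert (Hx1 : Rabs x <= m) by exact Hx. assert (Hy1 : Rabs y <= m) by exact Hy.
  assert (Hem : exp x = 1 + x + a) by (unfold a; ring).
  assert (Hex : Rabs (exp x) <= 3).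
  { rewrite Hem. eapply Rle_trans; [apply Rabs_triang|].
    assert (Rabs (1 + x) <= 1 + m) by (eapply Rle_trans; [apply Rabs_triang|]; rewrite Rabs_R1; lra).
    nra. }
  eapply Rle_trans; [apply Cmod_le_abs|].
  replace (Re (Cexp z - 1 - 1 * z)) with (a + exp x * c)
    by (unfold Cexp, a, c, x, y, Re, Im; simpl; ring).
  replace (Im (Cexp z - 1 - 1 * z)) with (exp x * b + (x + a) * y)
    by (unfold Cexp, a, b, x, y, Re, Im; simpl; ring).
  assert (A1 : Rabs (a + exp x * c) <= e * m + 3 * (e * m)).
  { eapply Rle_trans; [apply Rabs_triang|]. rewrite Rabs_mult.
    apply Rplus_le_compat; [exact Ha|]. apply Rmult_le_compat; try apply Rabs_pos; assumption. }
  assert (A2 : Rabs (exp x * b + (x + a) * y) <= 3 * (e * m) + (e + e) * m).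
  { eapply Rle_trans; [apply Rabs_triang|]. rewrite !Rabs_mult.
    apply Rplus_le_compat; apply Rmult_le_compat; try apply Rabs_pos; try assumption.
    eapply Rle_trans; [apply Rabs_triang|]. nra. }
  nra.
Qed.

Lemma Cexp_cder (z : C) : cder Cexp z (Cexp z).
Proof.
  assert (H : cder (fun y => Cexp z * Cexp (y - z))%C z (Cexp z)).
  { eapply cder_eq.
    - apply (cder_mult (fun _ => Cexp z) (fun y => Cexp (y - z))); [apply cder_const|].
      apply (cder_comp Cexp (fun y => y - z)%C).
      + replace (z - z)%C with (RtoC 0) by ring. apply Cexp_cder_0.
      + apply cder_minus; [apply cder_id|apply cder_const].
    - ring. }
  revert H. apply cder_ext_near with (r := 1); [lra|].
  intros y _. rewrite <- Cexp_plus. f_equal. ring.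
Qed.

(** Logarithms are only used in the right half-plane, which contains phi_car(D); there the argument
    is a single arctangent. *)
Lemma Carg_Re_pos (z : C) : 0 < Re z -> Carg z = atan (Im z / Re z).
Proof. intros H. unfold Carg. destruct (Rlt_dec 0 (Re z)); [reflexivity|contradiction]. Qed.

Lemma Cmod_Re_pos (z : C) : 0 < Re z -> Cmod z = Re z * sqrt (1 + (Im z / Re z)²).
Proof.
  intros H.
  assert (Hs : 0 < 1 + (Im z / Re z)²) by (assert (K := Rle_0_sqr (Im z / Re z)); lra).
  apply Rsqr_inj; [apply Cmod_ge_0| |].
  - apply Rmult_le_pos; [lra|apply sqrt_pos].
  - rewrite Rsqr_mult, Rsqr_sqrt by lra. unfold Rsqr at 1. rewrite Cmod_sqr.
    unfold Rsqr. field. lra.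
Qed.

Lemma Cexp_Clog (z : C) : 0 < Re z -> Cexp (Clog z) = z.
Proof.
  intros H. assert (Hm : 0 < Cmod z) by (assert (K := Re_le_Cmod z); lra).
  assert (Hs : 0 < sqrt (1 + (Im z / Re z)²))
    by (apply sqrt_lt_R0; assert (K := Rle_0_sqr (Im z / Re z)); lra).
  apply C_ext; unfold Cexp, Clog; simpl; rewrite exp_ln, Carg_Re_pos by assumption;
    rewrite ?cos_atan, ?sin_atan; rewrite (Cmod_Re_pos z H); field; lra.
Qed.

Lemma continuous_Re (z : C) : continuous (T := AbsRing_UniformSpace C_AbsRing) Re z.
Proof.
  apply filterlim_locally. intros eps. exists eps. intros y Hy.
  change (Rabs (Re y - Re z) < eps).
  change (Cmod (y - z) < eps) in Hy.
  eapply Rle_lt_trans; [|exact Hy].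
  assert (K := re_le_Cmod (y - z)). unfold Cminus in K at 1. rewrite re_plus, re_opp in K. exact K.
Qed.

Lemma continuous_Im (z : C) : continuous (T := AbsRing_UniformSpace C_AbsRing) Im z.
Proof.
  apply filterlim_locally. intros eps. exists eps. intros y Hy.
  change (Rabs (Im y - Im z) < eps).
  change (Cmod (y - z) < eps) in Hy.
  eapply Rle_lt_trans; [|exact Hy].
  assert (K := im_le_Cmod (y - z)). unfold Cminus in K at 1. rewrite im_plus, im_opp in K. exact K.
Qed.

Lemma ccont_pair (u v : C -> R) (z : C) :
  continuous (T := AbsRing_UniformSpace C_AbsRing) u z ->
  continuous (T := AbsRing_UniformSpace C_AbsRing) v z ->
  ccont (fun y => (u y, v y)) z.
Proof.
  intros Hu Hv eps Heps.
  assert (He : 0 < eps / 2) by lra.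
  destruct (proj1 (filterlim_locally _ _) Hu (mkposreal _ He)) as [d1 H1].
  destruct (proj1 (filterlim_locally _ _) Hv (mkposreal _ He)) as [d2 H2].
  exists (Rmin d1 d2). split; [apply Rmin_glb_lt; apply cond_pos|].
  intros y Hy.
  specialize (H1 y (Rlt_le_trans _ _ _ Hy (Rmin_l _ _))).
  specialize (H2 y (Rlt_le_trans _ _ _ Hy (Rmin_r _ _))).
  change (Rabs (u y - u z) < eps / 2) in H1.
  change (Rabs (v y - v z) < eps / 2) in H2.
  eapply Rle_lt_trans; [apply Cmod_le_abs|]. simpl.
  unfold Rminus in *. lra.
Qed.

Lemma Clog_ccont (z : C) : 0 < Re z -> ccont Clog z.
Proof.
  intros Hz.
  assert (Hm : 0 < Cmod z) by (assert (K := Re_le_Cmod z); lra).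
  assert (Hc : ccont (fun y => (ln (Cmod y), atan (Im y / Re y))) z).
  { apply ccont_pair.
    - apply (continuous_comp (U := AbsRing_UniformSpace C_AbsRing) Cmod ln).
      + apply filterlim_locally. intros eps. exists eps. intros y Hy.
        change (Cmod (y - z) < eps) in Hy. change (Rabs (Cmod y - Cmod z) < eps).
        assert (K1 := Cmod_ge_minus y z). assert (K2 := Cmod_ge_minus z y).
        rewrite Cmod_minus_sym in K2. apply Rabs_def1; lra.
      + apply continuity_pt_filterlim. apply derivable_continuous_pt.
        exists (/ Cmod z). apply derivable_pt_lim_ln. exact Hm.
    - apply (continuous_comp (U := AbsRing_UniformSpace C_AbsRing) (fun y : C => Im y / Re y) atan).
      + apply (continuous_mult (U := AbsRing_UniformSpace C_AbsRing) (K := R_AbsRing)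
                 Im (fun y => / Re y)); [apply continuous_Im|].
        apply (continuous_comp (U := AbsRing_UniformSpace C_AbsRing) Re Rinv); [apply continuous_Re|].
        apply continuous_Rinv. lra.
      + apply continuity_pt_filterlim. apply derivable_continuous_pt.
        apply derivable_pt_atan. }
  intros eps Heps. destruct (Hc eps Heps) as [d [Hd H]].
  exists (Rmin d (Re z)). split; [apply Rmin_glb_lt; assumption|].
  intros y Hy.
  specialize (H y (Rlt_le_trans _ _ _ Hy (Rmin_l _ _))).
  assert (Hy2 := Rlt_le_trans _ _ _ Hy (Rmin_r _ _)).
  assert (Hry : 0 < Re y).
  { assert (K := Re_ge_opp_Cmod (y - z)).
    unfold Cminus in K at 2. rewrite re_plus, re_opp in K. lra. }
  unfold Clog. rewrite !Carg_Re_pos by assumption. exact H.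
Qed.

Lemma Clog_holo (z : C) : 0 < Re z -> holo Clog z.
Proof.
  intros Hz. eexists. eapply (cder_inverse Clog Cexp z _ (Re z) Hz).
  - intros y Hy. apply Cexp_Clog.
    assert (K := Re_ge_opp_Cmod (y - z)).
    unfold Cminus in K at 2. rewrite re_plus, re_opp in K. lra.
  - apply Clog_ccont. exact Hz.
  - apply Cexp_cder.
  - apply Cexp_nz.
Qed.

Lemma Clog_1 : Clog 1 = 0%C.
Proof.
  unfold Clog. rewrite Cmod_1, ln_1, Carg_Re_pos by (simpl; lra).
  simpl. unfold Rdiv. rewrite Rmult_0_l, atan_0. reflexivity.
Qed.

Lemma Clog_Cexp (z : C) : - (PI / 2) < Im z < PI / 2 -> Clog (Cexp z) = z.
Proof.
  intros H. assert (Hc : 0 < cos (Im z)) by (apply cos_gt_0; lra).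
  assert (He := exp_pos (Re z)).
  assert (Hr : 0 < Re (Cexp z)) by (simpl; apply Rmult_lt_0_compat; assumption).
  unfold Clog. rewrite Cmod_Cexp, ln_exp, Carg_Re_pos by exact Hr. simpl.
  replace (exp (Re z) * sin (Im z) / (exp (Re z) * cos (Im z))) with (tan (Im z))
    by (unfold tan; field; lra).
  rewrite atan_tan by lra. destruct z; reflexivity.
Qed.

(** * Goursat's theorem for rectangles *)

Definition tcont (g : R -> C) (t : R) : Prop :=
  continuous (fun s => Re (g s)) t /\ continuous (fun s => Im (g s)) t.

Lemma tcont_eps (g : R -> C) (t : R) :
  tcont g t <-> forall eps, 0 < eps -> exists delta, 0 < delta /\
    forall s, Rabs (s - t) < delta -> Cmod (g s - g t) < eps.
Proof.
  split.
  - intros [H1 H2] eps Heps. assert (He : 0 < eps / 2) by lra.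
    destruct (proj1 (filterlim_locally _ _) H1 (mkposreal _ He)) as [d1 K1].
    destruct (proj1 (filterlim_locally _ _) H2 (mkposreal _ He)) as [d2 K2].
    exists (Rmin d1 d2). split; [apply Rmin_glb_lt; apply cond_pos|].
    intros s Hs.
    specialize (K1 s (Rlt_le_trans _ _ _ Hs (Rmin_l _ _))).
    specialize (K2 s (Rlt_le_trans _ _ _ Hs (Rmin_r _ _))).
    change (Rabs (Re (g s) - Re (g t)) < eps / 2) in K1.
    change (Rabs (Im (g s) - Im (g t)) < eps / 2) in K2.
    eapply Rle_lt_trans; [apply Cmod_le_abs|].
    unfold Cminus. rewrite re_plus, im_plus, re_opp, im_opp. unfold Rminus in *. lra.
  - intros H. split; apply filterlim_locally; intros eps;
      destruct (H eps (cond_pos eps)) as [d [Hd K]]; exists (mkposreal d Hd);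
      intros s Hs; specialize (K s Hs); (eapply Rle_lt_trans; [|exact K]).
    + assert (L := re_le_Cmod (g s - g t)). unfold Cminus in L at 1.
      rewrite re_plus, re_opp in L. exact L.
    + assert (L := im_le_Cmod (g s - g t)). unfold Cminus in L at 1.
      rewrite im_plus, im_opp in L. exact L.
Qed.

Lemma tcont_comp (f : C -> C) (g : R -> C) (t : R) :
  ccont f (g t) -> tcont g t -> tcont (fun s => f (g s)) t.
Proof.
  intros Hf Hg. apply tcont_eps. intros eps Heps.
  destruct (Hf eps Heps) as [d [Hd H]].
  destruct (proj1 (tcont_eps g t) Hg d Hd) as [d' [Hd' H']].
  exists d'. split; [exact Hd'|]. intros s Hs. apply H. apply H'. exact Hs.
Qed.

Lemma tcont_mult (g h : R -> C) (t : R) :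
  tcont g t -> tcont h t -> tcont (fun s => g s * h s)%C t.
Proof.
  intros [G1 G2] [H1 H2]. split.
  - apply (continuous_minus (fun s => Re (g s) * Re (h s)) (fun s => Im (g s) * Im (h s)));
      apply (continuous_mult (K := R_AbsRing)); assumption.
  - apply (continuous_plus (fun s => Re (g s) * Im (h s)) (fun s => Im (g s) * Re (h s)));
      apply (continuous_mult (K := R_AbsRing)); assumption.
Qed.

Lemma tcont_plus (g h : R -> C) (t : R) :
  tcont g t -> tcont h t -> tcont (fun s => g s + h s)%C t.
Proof.
  intros [G1 G2] [H1 H2]. split.
  - exact (continuous_plus (V := R_NormedModule) (fun s => Re (g s)) (fun s => Re (h s)) t G1 H1).
  - exact (continuous_plus (V := R_NormedModule) (fun s => Im (g s)) (fun s => Im (h s)) t G2 H2).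
Qed.

Lemma tcont_const (c : C) (t : R) : tcont (fun _ => c) t.
Proof. split; apply continuous_const. Qed.

Definition hline (y t : R) : C := (t, y).
Definition vline (x t : R) : C := (x, t).

Lemma tcont_hline (y t : R) : tcont (hline y) t.
Proof. split; [apply continuous_id|apply continuous_const]. Qed.

Lemma tcont_vline (x t : R) : tcont (vline x) t.
Proof. split; [apply continuous_const|apply continuous_id]. Qed.

Definition Cint (g : R -> C) (a b : R) : C :=
  (RInt (fun t => Re (g t)) a b, RInt (fun t => Im (g t)) a b).

Definition tcont_on (g : R -> C) (a b : R) : Prop := forall t, a <= t <= b -> tcont g t.

Lemma tcont_on_ex (g : R -> C) (a b : R) : a <= b -> tcont_on g a b ->
  ex_RInt (fun t => Re (g t)) a b /\ ex_RInt (fun t => Im (g t)) a b.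
Proof.
  intros Hab H.
  split.
  - apply (ex_RInt_continuous (V := R_CompleteNormedModule) (fun t => Re (g t))); intros t Ht.
    rewrite Rmin_left, Rmax_right in Ht by exact Hab. exact (proj1 (H t Ht)).
  - apply (ex_RInt_continuous (V := R_CompleteNormedModule) (fun t => Im (g t))); intros t Ht.
    rewrite Rmin_left, Rmax_right in Ht by exact Hab. exact (proj2 (H t Ht)).
Qed.

(* [RInt] types its values in a [NormedModule], where [ring] and [field] do not recognize [R]. *)
Ltac eq_in_R := lazymatch goal with |- ?a = ?b => change (@eq R a b) end.

Lemma Cint_lin (c d : C) (g h : R -> C) (a b : R) : a <= b ->
  tcont_on g a b -> tcont_on h a b ->
  Cint (fun t => c * g t + d * h t)%C a b = (c * Cint g a b + d * Cint h a b)%C.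
Proof.
  intros Hab Hg Hh.
  destruct (tcont_on_ex g a b Hab Hg) as [G1 G2].
  destruct (tcont_on_ex h a b Hab Hh) as [H1 H2].
  (* Each component of a complex linear combination mixes all four real integrals, so one real
     identity serves both components. *)
  assert (K : forall (p q r s : R) (u v w x : R -> R),
    ex_RInt u a b -> ex_RInt v a b -> ex_RInt w a b -> ex_RInt x a b ->
    RInt (fun t => (p * u t + q * v t) + (r * w t + s * x t)) a b
    = (p * RInt u a b + q * RInt v a b) + (r * RInt w a b + s * RInt x a b)).
  { intros p q r s u v w x Hu Hv Hw Hx. apply is_RInt_unique.
    apply (is_RInt_plus (V := R_NormedModule));
      apply (is_RInt_plus (V := R_NormedModule));
      apply (is_RInt_scal (V := R_NormedModule));
      apply (RInt_correct (V := R_CompleteNormedModule)); assumption. }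
  apply C_ext; unfold Cint at 1; cbn [Re Im fst snd].
  - transitivity ((Re c * Re (Cint g a b) + (- Im c) * Im (Cint g a b))
      + (Re d * Re (Cint h a b) + (- Im d) * Im (Cint h a b))).
    + unfold Cint; cbn [Re Im fst snd]. rewrite <- K by assumption.
      apply RInt_ext. intros t _. rewrite re_plus, !re_mult. eq_in_R. ring.
    + rewrite re_plus, !re_mult. eq_in_R. ring.
  - transitivity ((Im c * Re (Cint g a b) + Re c * Im (Cint g a b))
      + (Im d * Re (Cint h a b) + Re d * Im (Cint h a b))).
    + unfold Cint; cbn [Re Im fst snd]. rewrite <- K by assumption.
      apply RInt_ext. intros t _. rewrite im_plus, !im_mult. eq_in_R. ring.
    + rewrite im_plus, !im_mult. eq_in_R. ring.
Qed.

Lemma Cint_ext (g h : R -> C) (a b : R) : a <= b ->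
  (forall t, a <= t <= b -> g t = h t) -> Cint g a b = Cint h a b.
Proof.
  intros Hab H. unfold Cint. f_equal; apply RInt_ext; intros t Ht;
    rewrite Rmin_left, Rmax_right in Ht by exact Hab; rewrite H by lra; reflexivity.
Qed.

Lemma Cint_Chasles (g : R -> C) (a b c : R) : a <= b <= c -> tcont_on g a c ->
  Cint g a c = (Cint g a b + Cint g b c)%C.
Proof.
  intros [Hab Hbc] H.
  destruct (tcont_on_ex g a b Hab) as [G1 G2]; [intros t Ht; apply H; lra|].
  destruct (tcont_on_ex g b c Hbc) as [H1 H2]; [intros t Ht; apply H; lra|].
  apply C_ext; rewrite ?re_plus, ?im_plus; symmetry;
    apply (RInt_Chasles (V := R_CompleteNormedModule)); assumption.
Qed.

(** The factor 2 comes from estimating the two components separately; the arguments below only use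
    the order of magnitude. *)
Lemma Cint_bound (g : R -> C) (a b M : R) : a <= b -> tcont_on g a b ->
  (forall t, a <= t <= b -> Cmod (g t) <= M) -> Cmod (Cint g a b) <= 2 * M * (b - a).
Proof.
  intros Hab H HM.
  destruct (tcont_on_ex g a b Hab H) as [G1 G2].
  eapply Rle_trans; [apply Cmod_le_abs|].
  assert (B1 : Rabs (Re (Cint g a b)) <= (b - a) * M).
  { apply abs_RInt_le_const; [exact Hab|exact G1|].
    intros t Ht. eapply Rle_trans; [apply re_le_Cmod|apply HM; exact Ht]. }
  assert (B2 : Rabs (Im (Cint g a b)) <= (b - a) * M).
  { apply abs_RInt_le_const; [exact Hab|exact G2|].
    intros t Ht. eapply Rle_trans; [apply im_le_Cmod|apply HM; exact Ht]. }
  lra.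
Qed.

Lemma Cint_affine (p q : C) (a b : R) :
  Cint (fun t => p + q * RtoC t)%C a b
  = (RtoC (b - a) * (p + q * RtoC ((a + b) / 2)))%C.
Proof.
  assert (K : forall u v : R,
    RInt (fun t => u + v * t) a b = (b - a) * (u + v * ((a + b) / 2))).
  { intros u v. apply is_RInt_unique.
    replace ((b - a) * (u + v * ((a + b) / 2)))
      with (minus (u * b + v * (b * b) / 2) (u * a + v * (a * a) / 2))
      by (unfold minus, plus, opp; simpl; eq_in_R; field).
    apply (is_RInt_derive (fun t => u * t + v * (t * t) / 2)).
    - intros t _. auto_derive; [exact I|eq_in_R; field].
    - intros t _. apply (continuous_plus (fun _ => u) (fun t => v * t)).
      + apply continuous_const.
      + apply (continuous_mult (K := R_AbsRing)); [apply continuous_const|apply continuous_id]. }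
  apply C_ext.
  - transitivity (RInt (fun t => Re p + Re q * t) a b).
    + apply RInt_ext. intros t _. rewrite re_plus, re_scal_r. reflexivity.
    + rewrite K, re_scal_l, re_plus, re_scal_r. reflexivity.
  - transitivity (RInt (fun t => Im p + Im q * t) a b).
    + apply RInt_ext. intros t _. rewrite im_plus, im_scal_r. reflexivity.
    + rewrite K, im_scal_l, im_plus, im_scal_r. reflexivity.
Qed.

(** * Contour integrals over boundaries of rectangles *)

(** The integral over the boundary, counterclockwise: dz is dt on horizontal sides and i dt on
    vertical ones. *)
Definition Rint (f : C -> C) (x0 x1 y0 y1 : R) : C :=
  (Cint (fun t => f (hline y0 t)) x0 x1 - Cint (fun t => f (hline y1 t)) x0 x1
   + Ci * (Cint (fun t => f (vline x1 t)) y0 y1 - Cint (fun t => f (vline x0 t)) y0 y1))%C.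

Definition box (x0 x1 y0 y1 : R) (z : C) : Prop := x0 <= Re z <= x1 /\ y0 <= Im z <= y1.

Definition bdry (x0 x1 y0 y1 : R) (z : C) : Prop :=
  box x0 x1 y0 y1 z /\ (Re z = x0 \/ Re z = x1 \/ Im z = y0 \/ Im z = y1).

Definition bdry_cont (f : C -> C) (x0 x1 y0 y1 : R) : Prop :=
  forall z, bdry x0 x1 y0 y1 z -> ccont f z.

Ltac solve_bdry :=
  unfold bdry, box, hline, vline; simpl;
  split; [split; lra|first [left; lra|right; left; lra|right; right; left; lra|right; right; right; lra]].

Lemma bdry_cont_sides (f : C -> C) (x0 x1 y0 y1 : R) : x0 <= x1 -> y0 <= y1 ->
  bdry_cont f x0 x1 y0 y1 ->
  tcont_on (fun t => f (hline y0 t)) x0 x1 /\ tcont_on (fun t => f (hline y1 t)) x0 x1 /\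
  tcont_on (fun t => f (vline x0 t)) y0 y1 /\ tcont_on (fun t => f (vline x1 t)) y0 y1.
Proof.
  intros Hx Hy H.
  split; [|split; [|split]]; intros t Ht;
    (apply tcont_comp; [apply H; solve_bdry|first [apply tcont_hline|apply tcont_vline]]).
Qed.

Lemma Rint_lin (c d : C) (f g : C -> C) (x0 x1 y0 y1 : R) : x0 <= x1 -> y0 <= y1 ->
  bdry_cont f x0 x1 y0 y1 -> bdry_cont g x0 x1 y0 y1 ->
  Rint (fun z => c * f z + d * g z)%C x0 x1 y0 y1
  = (c * Rint f x0 x1 y0 y1 + d * Rint g x0 x1 y0 y1)%C.
Proof.
  intros Hx Hy Hf Hg.
  destruct (bdry_cont_sides f x0 x1 y0 y1 Hx Hy Hf) as [F1 [F2 [F3 F4]]].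
  destruct (bdry_cont_sides g x0 x1 y0 y1 Hx Hy Hg) as [G1 [G2 [G3 G4]]].
  unfold Rint.
  rewrite (Cint_lin c d (fun t => f (hline y0 t)) (fun t => g (hline y0 t))) by assumption.
  rewrite (Cint_lin c d (fun t => f (hline y1 t)) (fun t => g (hline y1 t))) by assumption.
  rewrite (Cint_lin c d (fun t => f (vline x0 t)) (fun t => g (vline x0 t))) by assumption.
  rewrite (Cint_lin c d (fun t => f (vline x1 t)) (fun t => g (vline x1 t))) by assumption.
  ring.
Qed.

Lemma Rint_ext (f g : C -> C) (x0 x1 y0 y1 : R) : x0 <= x1 -> y0 <= y1 ->
  (forall z, bdry x0 x1 y0 y1 z -> f z = g z) ->
  Rint f x0 x1 y0 y1 = Rint g x0 x1 y0 y1.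
Proof.
  intros Hx Hy H. unfold Rint.
  rewrite (Cint_ext (fun t => f (hline y0 t)) (fun t => g (hline y0 t)) x0 x1 Hx)
    by (intros; apply H; solve_bdry).
  rewrite (Cint_ext (fun t => f (hline y1 t)) (fun t => g (hline y1 t)) x0 x1 Hx)
    by (intros; apply H; solve_bdry).
  rewrite (Cint_ext (fun t => f (vline x0 t)) (fun t => g (vline x0 t)) y0 y1 Hy)
    by (intros; apply H; solve_bdry).
  rewrite (Cint_ext (fun t => f (vline x1 t)) (fun t => g (vline x1 t)) y0 y1 Hy)
    by (intros; apply H; solve_bdry).
  reflexivity.
Qed.

(** Each side contributes its length times the midpoint value. Bottom minus top gives -i q times the
    area, and i times right minus left gives +i q times the area. *)
Lemma Rint_affine (p q : C) (x0 x1 y0 y1 : R) :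
  Rint (fun z => p + q * z)%C x0 x1 y0 y1 = 0%C.
Proof.
  assert (Hh : forall y, Cint (fun t => p + q * hline y t)%C x0 x1
    = (RtoC (x1 - x0) * (p + q * (Ci * RtoC y) + q * RtoC ((x0 + x1) / 2)))%C).
  { intros y. rewrite <- Cint_affine. f_equal.
    apply functional_extensionality. intros t.
    apply C_ext; simpl; ring. }
  assert (Hv : forall x, Cint (fun t => p + q * vline x t)%C y0 y1
    = (RtoC (y1 - y0) * (p + q * RtoC x + (q * Ci) * RtoC ((y0 + y1) / 2)))%C).
  { intros x. rewrite <- Cint_affine. f_equal.
    apply functional_extensionality. intros t.
    apply C_ext; simpl; ring. }
  unfold Rint. rewrite !Hh, !Hv.
  apply C_ext; simpl; field.
Qed.

Lemma Rint_bound (f : C -> C) (x0 x1 y0 y1 M : R) : x0 <= x1 -> y0 <= y1 ->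
  bdry_cont f x0 x1 y0 y1 -> (forall z, bdry x0 x1 y0 y1 z -> Cmod (f z) <= M) ->
  Cmod (Rint f x0 x1 y0 y1) <= 4 * M * ((x1 - x0) + (y1 - y0)).
Proof.
  intros Hx Hy Hf HM.
  destruct (bdry_cont_sides f x0 x1 y0 y1 Hx Hy Hf) as [F1 [F2 [F3 F4]]].
  assert (B1 := Cint_bound (fun t => f (hline y0 t)) x0 x1 M Hx F1
    ltac:(intros; apply HM; solve_bdry)).
  assert (B2 := Cint_bound (fun t => f (hline y1 t)) x0 x1 M Hx F2
    ltac:(intros; apply HM; solve_bdry)).
  assert (B3 := Cint_bound (fun t => f (vline x0 t)) y0 y1 M Hy F3
    ltac:(intros; apply HM; solve_bdry)).
  assert (B4 := Cint_bound (fun t => f (vline x1 t)) y0 y1 M Hy F4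
    ltac:(intros; apply HM; solve_bdry)).
  unfold Rint, Cminus.
  eapply Rle_trans; [apply Cmod_triangle|]. rewrite Cmod_mult, Cmod_Ci, Rmult_1_l.
  eapply Rle_trans; [apply Rplus_le_compat; apply Cmod_triangle|]. rewrite !Cmod_opp.
  lra.
Qed.

Lemma Rint_split_x (f : C -> C) (x0 x1 x2 y0 y1 : R) : x0 <= x1 <= x2 -> y0 <= y1 ->
  bdry_cont f x0 x2 y0 y1 ->
  Rint f x0 x2 y0 y1 = (Rint f x0 x1 y0 y1 + Rint f x1 x2 y0 y1)%C.
Proof.
  intros Hx Hy H.
  destruct (bdry_cont_sides f x0 x2 y0 y1 ltac:(lra) Hy H) as [F1 [F2 [F3 F4]]].
  unfold Rint.
  rewrite (Cint_Chasles (fun t => f (hline y0 t)) x0 x1 x2 Hx F1).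
  rewrite (Cint_Chasles (fun t => f (hline y1 t)) x0 x1 x2 Hx F2). ring.
Qed.

Lemma Rint_split_y (f : C -> C) (x0 x1 y0 y1 y2 : R) : x0 <= x1 -> y0 <= y1 <= y2 ->
  bdry_cont f x0 x1 y0 y2 ->
  Rint f x0 x1 y0 y2 = (Rint f x0 x1 y0 y1 + Rint f x0 x1 y1 y2)%C.
Proof.
  intros Hx Hy H.
  destruct (bdry_cont_sides f x0 x1 y0 y2 Hx ltac:(lra) H) as [F1 [F2 [F3 F4]]].
  unfold Rint.
  rewrite (Cint_Chasles (fun t => f (vline x0 t)) y0 y1 y2 Hy F3).
  rewrite (Cint_Chasles (fun t => f (vline x1 t)) y0 y1 y2 Hy F4). ring.
Qed.

Lemma nested_point (a b : nat -> R) :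
  (forall n, a n <= a (S n) /\ b (S n) <= b n /\ a n <= b n) ->
  exists p, forall n, a n <= p <= b n.
Proof.
  intros H.
  assert (Ha : forall n m, a n <= a (n + m)%nat).
  { intros n; induction m; [rewrite Nat.add_0_r; lra|].
    rewrite Nat.add_succ_r. destruct (H (n + m)%nat). lra. }
  assert (Hb : forall n m, b (n + m)%nat <= b n).
  { intros n; induction m; [rewrite Nat.add_0_r; lra|].
    rewrite Nat.add_succ_r. destruct (H (n + m)%nat). lra. }
  assert (Hab : forall m n, a m <= b n).
  { intros m n. destruct (H (m + n)%nat) as [_ [_ K]].
    specialize (Ha m n). specialize (Hb n m). rewrite Nat.add_comm in Hb. lra. }
  destruct (completeness (fun x => exists n, x = a n)) as [p [P1 P2]].
  - exists (b 0%nat). intros x [n ->]. apply Hab.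
  - exists (a 0%nat), 0%nat. reflexivity.
  - exists p. intros n. split.
    + apply P1. exists n. reflexivity.
    + apply P2. intros x [m ->]. apply Hab.
Qed.

(** * Goursat's bisection argument *)

Section Goursat.
Variables (f : C -> C) (X0 X1 Y0 Y1 : R).
Hypothesis (Hf : forall z, box X0 X1 Y0 Y1 z -> holo f z).

Let inside (x0 x1 y0 y1 : R) : Prop :=
  X0 <= x0 /\ x0 <= x1 /\ x1 <= X1 /\ Y0 <= y0 /\ y0 <= y1 /\ y1 <= Y1.

Lemma inside_bdry_cont (x0 x1 y0 y1 : R) : inside x0 x1 y0 y1 -> bdry_cont f x0 x1 y0 y1.
Proof.
  unfold inside. intros H z [[K1 K2] _]. apply holo_ccont. apply Hf. split; lra.
Qed.

(** Halving both sides divides the squared half-perimeter by 4, and the four integrals over the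
    quarters add up to the whole one. Hence some quarter inherits the lower bound with the same
    k. *)
Lemma Goursat_step (k x0 x1 y0 y1 : R) : inside x0 x1 y0 y1 ->
  k * ((x1 - x0) + (y1 - y0)) ^ 2 < Cmod (Rint f x0 x1 y0 y1) ->
  exists x0' x1' y0' y1', inside x0' x1' y0' y1' /\
    x0 <= x0' /\ x1' <= x1 /\ y0 <= y0' /\ y1' <= y1 /\
    x1' - x0' = (x1 - x0) / 2 /\ y1' - y0' = (y1 - y0) / 2 /\
    k * ((x1' - x0') + (y1' - y0')) ^ 2 < Cmod (Rint f x0' x1' y0' y1').
Proof.
  intros Hin H. assert (Hin' := Hin). unfold inside in Hin'.
  set (x := (x0 + x1) / 2). set (y := (y0 + y1) / 2).
  assert (Hx : x0 <= x <= x1) by (unfold x; lra).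
  assert (Hy : y0 <= y <= y1) by (unfold y; lra).
  assert (E : Rint f x0 x1 y0 y1 = ((Rint f x0 x y0 y + Rint f x0 x y y1)
    + (Rint f x x1 y0 y + Rint f x x1 y y1))%C).
  { rewrite (Rint_split_x f x0 x x1 y0 y1 Hx) by (try lra; apply inside_bdry_cont; exact Hin).
    rewrite (Rint_split_y f x0 x y0 y y1) by (try lra; apply inside_bdry_cont; unfold inside; lra).
    rewrite (Rint_split_y f x x1 y0 y y1) by (try lra; apply inside_bdry_cont; unfold inside; lra).
    reflexivity. }
  set (s := (x1 - x0) + (y1 - y0)) in *.
  assert (T : Cmod (Rint f x0 x1 y0 y1) <= (Cmod (Rint f x0 x y0 y) + Cmod (Rint f x0 x y y1))
    + (Cmod (Rint f x x1 y0 y) + Cmod (Rint f x x1 y y1))).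
  { rewrite E. eapply Rle_trans; [apply Cmod_triangle|].
    apply Rplus_le_compat; apply Cmod_triangle. }
  assert (S4 : k * (s / 2) ^ 2 = k * s ^ 2 / 4) by field.
  assert (D : forall x0' x1' y0' y1', inside x0' x1' y0' y1' ->
    x0 <= x0' -> x1' <= x1 -> y0 <= y0' -> y1' <= y1 ->
    x1' - x0' = (x1 - x0) / 2 -> y1' - y0' = (y1 - y0) / 2 ->
    k * (s / 2) ^ 2 < Cmod (Rint f x0' x1' y0' y1') ->
    exists x0' x1' y0' y1', inside x0' x1' y0' y1' /\
    x0 <= x0' /\ x1' <= x1 /\ y0 <= y0' /\ y1' <= y1 /\
    x1' - x0' = (x1 - x0) / 2 /\ y1' - y0' = (y1 - y0) / 2 /\
    k * ((x1' - x0') + (y1' - y0')) ^ 2 < Cmod (Rint f x0' x1' y0' y1')).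
  { intros x0' x1' y0' y1' P0 P1 P2 P3 P4 P5 P6 P7. exists x0', x1', y0', y1'.
    repeat (split; [assumption|]). rewrite P5, P6.
    replace ((x1 - x0) / 2 + (y1 - y0) / 2) with (s / 2) by (unfold s; field). exact P7. }
  destruct (Rlt_dec (k * (s / 2) ^ 2) (Cmod (Rint f x0 x y0 y))) as [H1|H1];
    [eapply (D x0 x y0 y); unfold inside, x, y in *; lra|].
  destruct (Rlt_dec (k * (s / 2) ^ 2) (Cmod (Rint f x0 x y y1))) as [H2|H2];
    [eapply (D x0 x y y1); unfold inside, x, y in *; lra|].
  destruct (Rlt_dec (k * (s / 2) ^ 2) (Cmod (Rint f x x1 y0 y))) as [H3|H3];
    [eapply (D x x1 y0 y); unfold inside, x, y in *; lra|].
  destruct (Rlt_dec (k * (s / 2) ^ 2) (Cmod (Rint f x x1 y y1))) as [H4|H4];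
    [eapply (D x x1 y y1); unfold inside, x, y in *; lra|].
  exfalso. lra.
Qed.

(** Subtracting the affine approximation at p leaves the integral unchanged. The remainder is at
    most (k/4) s on the boundary, s being the half-perimeter, and [Rint_bound] contributes a factor
    4 s. *)
Lemma Goursat_local (p : C) (k : R) : 0 < k -> box X0 X1 Y0 Y1 p ->
  exists delta, 0 < delta /\ forall x0 x1 y0 y1, inside x0 x1 y0 y1 ->
    box x0 x1 y0 y1 p -> (x1 - x0) + (y1 - y0) < delta ->
    Cmod (Rint f x0 x1 y0 y1) <= k * ((x1 - x0) + (y1 - y0)) ^ 2.
Proof.
  intros Hk Hp. destruct (Hf p Hp) as [l Hl].
  assert (Hl' := Hl). rewrite cder_eps in Hl'.
  destruct (Hl' (k / 4) ltac:(lra)) as [d [Hd H]].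
  exists d. split; [exact Hd|].
  intros x0 x1 y0 y1 Hin [Hpx Hpy] Hs. assert (Hin' := Hin). unfold inside in Hin'.
  set (s := (x1 - x0) + (y1 - y0)) in *.
  pose (r := fun z => (1 * f z + (-1) * ((f p - l * p) + l * z))%C).
  assert (Haff : bdry_cont (fun z => (f p - l * p) + l * z)%C x0 x1 y0 y1).
  { intros z _. apply holo_ccont. apply holo_plus; [apply holo_const|].
    apply holo_mult; [apply holo_const|apply holo_id]. }
  assert (Hc := inside_bdry_cont x0 x1 y0 y1 Hin).
  assert (E : Rint r x0 x1 y0 y1 = Rint f x0 x1 y0 y1).
  { unfold r. rewrite (Rint_lin 1 (-1) f (fun z => (f p - l * p) + l * z)%C) by (assumption || lra).
    rewrite Rint_affine. ring. }
  rewrite <- E.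
  replace (k * s ^ 2) with (4 * (k / 4 * s) * s) by field.
  unfold s. apply Rint_bound; [lra|lra| |].
  - intros z Hz. apply holo_ccont. destruct Hz as [[Z1 Z2] _].
    unfold r.
    apply (holo_plus (fun z => 1 * f z)%C (fun z => (-1) * ((f p - l * p) + l * z))%C).
    + apply (holo_mult (fun _ => 1%C) f); [apply holo_const|]. apply Hf. split; lra.
    + apply (holo_mult (fun _ => (-1)%C) (fun z => (f p - l * p) + l * z)%C); [apply holo_const|].
      apply (holo_plus (fun _ => f p - l * p)%C (fun z => l * z)%C); [apply holo_const|].
      apply (holo_mult (fun _ => l) (fun z => z)); [apply holo_const|apply holo_id].
  - intros z [[Z1 Z2] _]. fold s.
    assert (Hzp : Cmod (z - p) <= s).
    { eapply Rle_trans; [apply Cmod_le_abs|].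
      unfold Cminus. rewrite re_plus, im_plus, re_opp, im_opp. unfold s.
      apply Rplus_le_compat; apply Rabs_le; lra. }
    replace (r z) with (f z - f p - l * (z - p))%C by (unfold r; ring).
    eapply Rle_trans; [apply H; lra|].
    apply Rmult_le_compat_l; lra.
Qed.

Lemma Goursat : X0 <= X1 -> Y0 <= Y1 -> Rint f X0 X1 Y0 Y1 = 0%C.
Proof.
  intros HX HY. apply Cmod_eq_0. apply Rle_antisym; [|apply Cmod_ge_0].
  apply Rnot_lt_le. intros Hpos.
  set (s0 := (X1 - X0) + (Y1 - Y0)).
  assert (exists k, 0 < k /\ k * s0 ^ 2 < Cmod (Rint f X0 X1 Y0 Y1)) as [k [Hk Hbad]].
  { set (I := Cmod (Rint f X0 X1 Y0 Y1)) in *.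
    (* The summand 1 keeps the denominator positive when the rectangle degenerates to a point. *)
    exists (I / (s0 ^ 2 + 1)). assert (Q : 0 <= s0 ^ 2) by apply pow2_ge_0. split.
    - apply Rdiv_lt_0_compat; lra.
    - apply Rmult_lt_reg_r with (s0 ^ 2 + 1); [lra|].
      replace (I / (s0 ^ 2 + 1) * s0 ^ 2 * (s0 ^ 2 + 1)) with (I * s0 ^ 2) by (field; lra).
      lra. }
  (* Rectangles are carried together with a proof that they violate the local estimate, so that
     choice can be iterated into a nested sequence. *)
  pose (bad := fun r : (R * R) * (R * R) =>
    let '((x0, x1), (y0, y1)) := r in
    inside x0 x1 y0 y1 /\ k * ((x1 - x0) + (y1 - y0)) ^ 2 < Cmod (Rint f x0 x1 y0 y1)).
  pose (next := fun (r r' : sig bad) =>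
    let '((x0, x1), (y0, y1)) := proj1_sig r in
    let '((x0', x1'), (y0', y1')) := proj1_sig r' in
    x0 <= x0' /\ x1' <= x1 /\ y0 <= y0' /\ y1' <= y1 /\
    x1' - x0' = (x1 - x0) / 2 /\ y1' - y0' = (y1 - y0) / 2).
  assert (Hstep : forall r, exists r', next r r').
  { intros [[[x0 x1] [y0 y1]] [H1 H2]].
    destruct (Goursat_step k x0 x1 y0 y1 H1 H2)
      as [x0' [x1' [y0' [y1' [K0 [K1 [K2 [K3 [K4 [K5 [K6 K7]]]]]]]]]]].
    assert (B : bad ((x0', x1'), (y0', y1'))) by (split; assumption).
    exists (exist _ _ B). unfold next; simpl. tauto. }
  pose (step := fun r => proj1_sig (constructive_indefinite_description _ (Hstep r))).
  assert (Hs : forall r, next r (step r))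
    by (intros r; unfold step; apply proj2_sig).
  assert (B0 : bad ((X0, X1), (Y0, Y1))) by (split; [unfold inside; lra|exact Hbad]).
  pose (u := fix u n := match n with O => exist bad _ B0 | S m => step (u m) end).
  pose (a := fun n => fst (fst (proj1_sig (u n)))). pose (b := fun n => snd (fst (proj1_sig (u n)))).
  pose (c := fun n => fst (snd (proj1_sig (u n)))). pose (d := fun n => snd (snd (proj1_sig (u n)))).
  assert (Hbadn : forall n, inside (a n) (b n) (c n) (d n) /\
    k * ((b n - a n) + (d n - c n)) ^ 2 < Cmod (Rint f (a n) (b n) (c n) (d n))).
  { intros n. unfold a, b, c, d. destruct (u n) as [[[x0 x1] [y0 y1]] H]. exact H. }
  assert (Hn : forall n, a n <= a (S n) /\ b (S n) <= b n /\ c n <= c (S n) /\ d (S n) <= d n /\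
    b (S n) - a (S n) = (b n - a n) / 2 /\ d (S n) - c (S n) = (d n - c n) / 2).
  { intros n. assert (K := Hs (u n)). unfold next in K. unfold a, b, c, d. simpl.
    destruct (u n) as [[[x0 x1] [y0 y1]] H].
    destruct (step _) as [[[x0' x1'] [y0' y1']] H']. simpl in *. exact K. }
  assert (Hw : forall n, (b n - a n) + (d n - c n) = s0 * (/ 2) ^ n).
  { induction n; [unfold s0, a, b, c, d; simpl; ring|].
    destruct (Hn n) as [_ [_ [_ [_ [E1 E2]]]]]. rewrite E1, E2. simpl. lra. }
  destruct (nested_point a b) as [px Hpx].
  { intros n. destruct (Hbadn n) as [K _]. unfold inside in K. destruct (Hn n). lra. }
  destruct (nested_point c d) as [py Hpy].
  { intros n. destruct (Hbadn n) as [K _]. unfold inside in K. destruct (Hn n). lra. }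
  destruct (Goursat_local (px, py) k Hk) as [delta [Hd Hloc]].
  { split; [apply (Hpx O)|apply (Hpy O)]. }
  assert (Hs0 : 0 <= s0) by (unfold s0; lra).
  (* After N halvings the half-perimeter s0 / 2^N is below delta, and the local estimate at the
     common point contradicts the N-th lower bound. *)
  destruct (pow_lt_1_zero (/ 2)) with (y := delta / (s0 + 1)) as [N HN].
  { rewrite Rabs_right; lra. }
  { apply Rdiv_lt_0_compat; lra. }
  specialize (HN N (le_n N)).
  rewrite Rabs_right in HN by (apply Rle_ge, pow_le; lra).
  destruct (Hbadn N) as [K1 K2].
  apply (Rlt_not_le _ _ K2). apply Hloc; [exact K1|split; [apply Hpx|apply Hpy]|].
  rewrite Hw. assert (P : 0 < (/ 2) ^ N) by (apply pow_lt; lra).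
  apply Rle_lt_trans with ((s0 + 1) * (/ 2) ^ N); [nra|].
  apply Rmult_lt_compat_l with (r := s0 + 1) in HN; [|lra].
  replace ((s0 + 1) * (delta / (s0 + 1))) with delta in HN by (field; lra). exact HN.
Qed.

End Goursat.

(** * Cauchy's formula *)

Lemma holo_inv_sub (b z : C) : z <> b -> holo (fun y => / (y - b))%C z.
Proof.
  intros H. apply (holo_inv (fun y => y - b)%C).
  - apply holo_minus; [apply holo_id|apply holo_const].
  - apply Cminus_eq_contra. exact H.
Qed.

(* Four closed rectangles avoiding [b] are cut off, and the remaining square around [b] shrinks to it. *)
Lemma Rint_removable (g : C -> C) (x0 x1 y0 y1 : R) (b : C) (delta M : R) :
  x0 < Re b < x1 -> y0 < Im b < y1 ->
  (forall z, box x0 x1 y0 y1 z -> z <> b -> holo g z) ->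
  0 < delta -> (forall z, Cmod (z - b) < delta -> Cmod (g z) <= M) ->
  Rint g x0 x1 y0 y1 = 0%C.
Proof.
  intros Hx Hy Hg Hd HM.
  assert (HM0 : 0 <= M).
  { eapply Rle_trans; [apply (Cmod_ge_0 (g b))|]. apply HM.
    replace (b - b)%C with (RtoC 0) by ring. rewrite Cmod_0. exact Hd. }
  apply Cmod_eq_0. apply Rle_antisym; [|apply Cmod_ge_0].
  apply Rnot_lt_le. intros Hpos. set (I := Cmod (Rint g x0 x1 y0 y1)) in *.
  set (e0 := Rmin (Rmin (Re b - x0) (x1 - Re b)) (Rmin (Im b - y0) (y1 - Im b))).
  set (e := Rmin (e0 / 2) (Rmin (delta / 3) (I / (16 * M + 16)))).
  assert (He0 : 0 < e0) by (repeat apply Rmin_glb_lt; lra).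
  assert (He : 0 < e).
  { apply Rmin_glb_lt; [lra|]. apply Rmin_glb_lt; [lra|]. apply Rdiv_lt_0_compat; lra. }
  assert (E1 : e <= e0 / 2) by apply Rmin_l.
  assert (E2 : e <= delta / 3) by (eapply Rle_trans; [apply Rmin_r|apply Rmin_l]).
  assert (E3 : e <= I / (16 * M + 16)) by (eapply Rle_trans; [apply Rmin_r|apply Rmin_r]).
  assert (F1 : e0 <= Re b - x0) by (eapply Rle_trans; apply Rmin_l).
  assert (F2 : e0 <= x1 - Re b) by (eapply Rle_trans; [apply Rmin_l|apply Rmin_r]).
  assert (F3 : e0 <= Im b - y0) by (eapply Rle_trans; [apply Rmin_r|apply Rmin_l]).
  assert (F4 : e0 <= y1 - Im b) by (eapply Rle_trans; apply Rmin_r).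
  clearbody e e0.
  set (bx := Re b) in *. set (by_ := Im b) in *.
  assert (Hc : forall u0 u1 v0 v1, x0 <= u0 -> u1 <= x1 -> y0 <= v0 -> v1 <= y1 ->
    bx <> u0 -> bx <> u1 -> by_ <> v0 -> by_ <> v1 -> bdry_cont g u0 u1 v0 v1).
  { intros u0 u1 v0 v1 K1 K2 K3 K4 K5 K6 K7 K8 z [[Z1 Z2] Z3].
    apply holo_ccont. apply Hg; [split; lra|].
    intros ->. fold bx by_ in Z3. lra. }
  assert (HG : forall u0 u1 v0 v1, x0 <= u0 -> u0 <= u1 -> u1 <= x1 ->
    y0 <= v0 -> v0 <= v1 -> v1 <= y1 ->
    (bx < u0 \/ u1 < bx \/ by_ < v0 \/ v1 < by_) -> Rint g u0 u1 v0 v1 = 0%C).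
  { intros u0 u1 v0 v1 K1 K2 K3 K4 K5 K6 K7. apply Goursat; [|lra|lra].
    intros z [Z1 Z2]. apply Hg; [split; lra|]. intros ->. fold bx by_ in Z1, Z2. lra. }
  assert (E : Rint g x0 x1 y0 y1 = Rint g (bx - e) (bx + e) (by_ - e) (by_ + e)).
  { rewrite (Rint_split_x g x0 (bx - e) x1) by (try apply Hc; lra).
    rewrite (HG x0 (bx - e)) by lra.
    rewrite (Rint_split_x g (bx - e) (bx + e) x1) by (try apply Hc; lra).
    rewrite (HG (bx + e) x1) by lra.
    rewrite (Rint_split_y g (bx - e) (bx + e) y0 (by_ - e) y1) by (try apply Hc; lra).
    rewrite (HG (bx - e) (bx + e) y0) by lra.
    rewrite (Rint_split_y g (bx - e) (bx + e) (by_ - e) (by_ + e) y1) by (try apply Hc; lra).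
    rewrite (HG (bx - e) (bx + e) (by_ + e)) by lra. ring. }
  assert (B : I <= 4 * M * (((bx + e) - (bx - e)) + ((by_ + e) - (by_ - e)))).
  { unfold I. rewrite E. apply Rint_bound; [lra|lra|apply Hc; lra|].
    intros z [[Z1 Z2] _]. apply HM.
    eapply Rle_lt_trans; [apply Cmod_le_abs|].
    unfold Cminus. rewrite re_plus, im_plus, re_opp, im_opp. fold bx by_.
    assert (Rabs (Re z + - bx) <= e) by (apply Rabs_le; lra).
    assert (Rabs (Im z + - by_) <= e) by (apply Rabs_le; lra). lra. }
  apply Rmult_le_compat_l with (r := 16 * M + 16) in E3; [|lra].
  replace ((16 * M + 16) * (I / (16 * M + 16))) with I in E3 by (field; lra).
  nra.
Qed.

(** The difference quotient of f at b is bounded near b, so its integral vanishes by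
    [Rint_removable]; linearity splits it into the two sides. The winding integral stays as a
    factor. *)
Lemma Cauchy_formula (f : C -> C) (x0 x1 y0 y1 : R) (b : C) :
  x0 < Re b < x1 -> y0 < Im b < y1 ->
  (forall z, box x0 x1 y0 y1 z -> holo f z) ->
  Rint (fun z => f z / (z - b))%C x0 x1 y0 y1
  = (f b * Rint (fun z => 1 / (z - b))%C x0 x1 y0 y1)%C.
Proof.
  intros Hx Hy Hf.
  assert (Hb : box x0 x1 y0 y1 b) by (split; lra).
  destruct (Hf b Hb) as [l Hl]. rewrite cder_eps in Hl.
  destruct (Hl 1 Rlt_0_1) as [d [Hd H]].
  assert (Hne : forall z, bdry x0 x1 y0 y1 z -> z <> b).
  { intros z [[Z1 Z2] Z3] ->. lra. }
  assert (Hh : forall h : C -> C, (forall z, bdry x0 x1 y0 y1 z -> holo h z) ->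
    bdry_cont (fun z => h z / (z - b))%C x0 x1 y0 y1).
  { intros h Hh z Hz. apply holo_ccont.
    apply (holo_mult h (fun z => / (z - b))%C); [apply Hh; exact Hz|].
    apply holo_inv_sub. apply Hne. exact Hz. }
  assert (E : Rint (fun z => (f z - f b) / (z - b))%C x0 x1 y0 y1 = 0%C).
  { apply (Rint_removable _ x0 x1 y0 y1 b d (Cmod l + 1) Hx Hy); [|exact Hd|].
    - intros z Hz Hzb.
      apply (holo_mult (fun z => f z - f b)%C (fun z => / (z - b))%C).
      + apply holo_minus; [apply Hf; exact Hz|apply holo_const].
      + apply holo_inv_sub. exact Hzb.
    - intros z Hz. pose proof (Cmod_ge_0 l) as Hl0.
      (* At z = b the numerator is 0, so the quotient is 0 whatever value the inverse of 0 has. *)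
      destruct (Ceq_dec z b) as [->|Hzb].
      { replace ((f b - f b) / (b - b))%C with (RtoC 0) by (unfold Cdiv; ring).
        rewrite Cmod_0. lra. }
      assert (Hn := Cminus_eq_contra z b Hzb). assert (Hm := proj1 (Cmod_gt_0 _) Hn).
      rewrite Cmod_div by exact Hn.
      apply Rmult_le_reg_r with (Cmod (z - b)); [exact Hm|].
      unfold Rdiv. rewrite Rmult_assoc, Rinv_l, Rmult_1_r by lra.
      replace (f z - f b)%C with ((f z - f b - l * (z - b)) + l * (z - b))%C by ring.
      eapply Rle_trans; [apply Cmod_triangle|]. rewrite Cmod_mult.
      specialize (H z Hz). lra. }
  rewrite (Rint_ext _ (fun z => 1 * (f z / (z - b)) + (- f b) * (1 / (z - b)))%C) in E;
    [|lra|lra|].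
  2:{ intros z Hz. field. apply Cminus_eq_contra. apply Hne. exact Hz. }
  rewrite (Rint_lin 1 (- f b) (fun z => f z / (z - b))%C (fun z => 1 / (z - b))%C) in E.
  - apply Ceq_minus. rewrite <- E. ring.
  - lra.
  - lra.
  - apply Hh. intros z [Hz _]. apply Hf. exact Hz.
  - apply (Hh (fun _ => 1%C)). intros. apply holo_const.
Qed.

(** Its imaginary part is a sum of four positive terms: Im (1/(z - b)) is positive on the bottom
    side and negative on the top, Re (1/(z - b)) is positive on the right and negative on the left,
    which matches the signs of the orientation. *)
Lemma Rint_inv_nonzero (x0 x1 y0 y1 : R) (b : C) :
  x0 < Re b < x1 -> y0 < Im b < y1 ->
  Rint (fun z => 1 / (z - b))%C x0 x1 y0 y1 <> 0%C.
Proof.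
  intros Hx Hy.
  assert (Hc : bdry_cont (fun z => 1 / (z - b))%C x0 x1 y0 y1).
  { intros z Hz. apply holo_ccont.
    apply (holo_mult (fun _ => 1%C) (fun z => / (z - b))%C); [apply holo_const|].
    apply holo_inv_sub. destruct Hz as [[Z1 Z2] Z3]. intros ->. lra. }
  destruct (bdry_cont_sides _ x0 x1 y0 y1 ltac:(lra) ltac:(lra) Hc) as [F1 [F2 [F3 F4]]].
  assert (HRe : forall z, Re (1 / (z - b))%C
    = (Re z - Re b) / ((Re z - Re b) ^ 2 + (Im z - Im b) ^ 2)).
  { intros z. simpl. unfold Rdiv. rewrite !Rmult_1_l, !Rmult_0_l. unfold Re, Im. simpl. unfold Rminus; ring. }
  assert (HIm : forall z, Im (1 / (z - b))%C
    = (Im b - Im z) / ((Re z - Re b) ^ 2 + (Im z - Im b) ^ 2)).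
  { intros z. simpl. unfold Rdiv. rewrite !Rmult_1_l, !Rmult_0_l. unfold Re, Im, Rminus. simpl. ring. }
  assert (Hsq : forall u v : R, u <> 0 \/ v <> 0 -> 0 < u ^ 2 + v ^ 2).
  { intros u v [K|K]; apply pow2_gt_0 in K;
      [assert (L := pow2_ge_0 v)|assert (L := pow2_ge_0 u)]; lra. }
  assert (Hlt : forall (u : R -> R) p q, p < q -> (forall t, p <= t <= q -> continuous u t) ->
    (forall t, p < t < q -> 0 < u t) -> 0 < RInt u p q).
  { intros u p q Hpq K1 K2. apply RInt_gt_0; assumption. }
  assert (Hgt : forall (u : R -> R) p q, p < q -> (forall t, p <= t <= q -> continuous u t) ->
    (forall t, p < t < q -> u t < 0) -> RInt u p q < 0).
  { intros u p q Hpq K1 K2.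
    assert (K : 0 < RInt (fun t => - u t) p q).
    { apply Hlt; [exact Hpq| |].
      - intros t Ht. apply (continuous_opp (V := R_NormedModule) u). apply K1. exact Ht.
      - intros t Ht. specialize (K2 t Ht). lra. }
    assert (K3 : RInt (fun t => - u t) p q = - RInt u p q); [|lra].
    apply (RInt_opp (V := R_CompleteNormedModule) u p q).
    apply (ex_RInt_continuous (V := R_CompleteNormedModule)).
    intros t Ht. rewrite Rmin_left, Rmax_right in Ht by lra. apply K1. exact Ht. }
  assert (I1 : 0 < Im (Cint (fun t => 1 / (hline y0 t - b))%C x0 x1)).
  { apply Hlt; [lra|intros t Ht; apply (F1 t Ht)|].
    intros t Ht. rewrite HIm. change (Re (hline y0 t)) with t. change (Im (hline y0 t)) with y0. apply Rdiv_lt_0_compat; [lra|apply Hsq; (left; lra) || (right; lra)]. }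
  assert (I2 : Im (Cint (fun t => 1 / (hline y1 t - b))%C x0 x1) < 0).
  { apply Hgt; [lra|intros t Ht; apply (F2 t Ht)|].
    intros t Ht. rewrite HIm. change (Re (hline y1 t)) with t. change (Im (hline y1 t)) with y1.
    apply Ropp_lt_cancel. rewrite Ropp_0, <- Rdiv_opp_l. apply Rdiv_lt_0_compat; [lra|apply Hsq; (left; lra) || (right; lra)]. }
  assert (I3 : Re (Cint (fun t => 1 / (vline x0 t - b))%C y0 y1) < 0).
  { apply Hgt; [lra|intros t Ht; apply (F3 t Ht)|].
    intros t Ht. rewrite HRe. change (Re (vline x0 t)) with x0. change (Im (vline x0 t)) with t.
    apply Ropp_lt_cancel. rewrite Ropp_0, <- Rdiv_opp_l. apply Rdiv_lt_0_compat; [lra|apply Hsq; (left; lra) || (right; lra)]. }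
  assert (I4 : 0 < Re (Cint (fun t => 1 / (vline x1 t - b))%C y0 y1)).
  { apply Hlt; [lra|intros t Ht; apply (F4 t Ht)|].
    intros t Ht. rewrite HRe. change (Re (vline x1 t)) with x1. change (Im (vline x1 t)) with t. apply Rdiv_lt_0_compat; [lra|apply Hsq; (left; lra) || (right; lra)]. }
  intros E. apply (f_equal Im) in E. unfold Rint, Cminus in E.
  rewrite im_plus, im_mult, !im_plus, re_plus, !im_opp, re_opp in E.
  change (Re Ci) with 0 in E. change (Im Ci) with 1 in E. change (Im 0) with 0 in E. unfold Cminus in I1, I2, I3, I4. lra.
Qed.

(** * Differentiation of Cauchy integrals with respect to the pole *)

(** A quadratic remainder with a constant uniform in t integrates to a quadratic remainder, which is
    o(|z - z0|). *)
Lemma Cint_param_cder (k : R -> C -> C) (k' : R -> C) (a b : R) (z0 : C) (delta M : R) :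
  a <= b -> 0 < delta -> 0 <= M ->
  (forall z, Cmod (z - z0) < delta -> tcont_on (fun t => k t z) a b) ->
  tcont_on k' a b ->
  (forall t z, a <= t <= b -> Cmod (z - z0) < delta ->
    Cmod (k t z - k t z0 - k' t * (z - z0)) <= M * (Cmod (z - z0) * Cmod (z - z0))) ->
  cder (fun z => Cint (fun t => k t z) a b) z0 (Cint k' a b).
Proof.
  intros Hab Hd HM Hk Hk' H. apply cder_eps. intros eps Heps.
  assert (HMb : 0 <= 2 * M * (b - a)) by nra.
  exists (Rmin delta (eps / (2 * M * (b - a) + 1))). split.
  { apply Rmin_glb_lt; [exact Hd|apply Rdiv_lt_0_compat; lra]. }
  intros z Hz.
  assert (Hz1 := Rlt_le_trans _ _ _ Hz (Rmin_l _ _)).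
  assert (Hz2 := Rlt_le_trans _ _ _ Hz (Rmin_r _ _)).
  assert (Hz0 : Cmod (z0 - z0) < delta)
    by (replace (z0 - z0)%C with (RtoC 0) by ring; rewrite Cmod_0; exact Hd).
  assert (C1 : tcont_on (fun t => 1 * k t z + (-1) * k t z0)%C a b).
  { intros t Ht. apply tcont_plus; (apply tcont_mult; [apply tcont_const|]).
    - exact (Hk z Hz1 t Ht).
    - exact (Hk z0 Hz0 t Ht). }
  assert (E : (Cint (fun t => k t z) a b - Cint (fun t => k t z0) a b - Cint k' a b * (z - z0))%C
    = Cint (fun t => 1 * (1 * k t z + (-1) * k t z0) + (- (z - z0)) * k' t)%C a b).
  { rewrite (Cint_lin 1 (- (z - z0)) (fun t => 1 * k t z + (-1) * k t z0)%C k') by assumption.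
    rewrite (Cint_lin 1 (-1) (fun t => k t z) (fun t => k t z0)) by (try apply Hk; assumption).
    ring. }
  rewrite E. set (h := Cmod (z - z0)) in *.
  eapply Rle_trans; [apply (Cint_bound _ a b (M * (h * h)))|].
  - exact Hab.
  - intros t Ht. apply tcont_plus; (apply tcont_mult; [apply tcont_const|]).
    + exact (C1 t Ht).
    + exact (Hk' t Ht).
  - intros t Ht.
    replace (1 * (1 * k t z + -1 * k t z0) + - (z - z0) * k' t)%C
      with (k t z - k t z0 - k' t * (z - z0))%C by ring.
    apply H; assumption.
  - assert (Hh : 0 <= h) by apply Cmod_ge_0.
    apply Rmult_lt_compat_l with (r := 2 * M * (b - a) + 1) in Hz2; [|lra].
    replace ((2 * M * (b - a) + 1) * (eps / (2 * M * (b - a) + 1))) with eps in Hz2 by (field; lra).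
    nra.
Qed.

Lemma tcont_on_bounded (g : R -> C) (a b : R) : a <= b -> tcont_on g a b ->
  exists B, 0 <= B /\ forall t, a <= t <= b -> Cmod (g t) <= B.
Proof.
  intros Hab H.
  destruct (bounded_continuity (V := R_NormedModule) (fun t => Re (g t)) a b) as [B1 H1].
  { intros t Ht. exact (proj1 (H t Ht)). }
  destruct (bounded_continuity (V := R_NormedModule) (fun t => Im (g t)) a b) as [B2 H2].
  { intros t Ht. exact (proj2 (H t Ht)). }
  assert (K : forall t, a <= t <= b -> Cmod (g t) <= B1 + B2).
  { intros t Ht. eapply Rle_trans; [apply Cmod_le_abs|].
    specialize (H1 t Ht). specialize (H2 t Ht).
    change (Rabs (Re (g t)) < B1) in H1. change (Rabs (Im (g t)) < B2) in H2. lra. }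
  exists (B1 + B2). split; [|exact K].
  eapply Rle_trans; [apply (Cmod_ge_0 (g a))|]. apply K. lra.
Qed.

Lemma tcont_kernel (psi gam : R -> C) (t : R) (z : C) :
  tcont psi t -> tcont gam t -> gam t <> z ->
  tcont (fun s => psi s / (gam s - z))%C t.
Proof.
  intros Hp Hg Hz. apply (tcont_mult psi (fun s => / (gam s - z))%C); [exact Hp|].
  apply (tcont_comp (fun w => / (w - z))%C gam); [|exact Hg].
  apply holo_ccont. apply holo_inv_sub. exact Hz.
Qed.

(** For |z - z0| < eta/2 the path stays at distance at least eta/2 from z. The remainders of 1/(gam
    - z) and 1/(gam - z)^2 are explicit rational functions divisible by (z - z0)^2, hence uniformly
    quadratic. The second conclusion is what makes a derivative differentiable again. *)
Lemma Cauchy_kernel_cder (psi gam : R -> C) (a b eta : R) (z0 : C) : a <= b ->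
  tcont_on psi a b -> tcont_on gam a b -> 0 < eta ->
  (forall t, a <= t <= b -> eta <= Cmod (gam t - z0)) ->
  cder (fun z => Cint (fun t => psi t / (gam t - z)) a b)%C z0
       (Cint (fun t => psi t / (gam t - z0) / (gam t - z0)) a b)%C
  /\ holo (fun z => Cint (fun t => psi t / (gam t - z) / (gam t - z)) a b)%C z0.
Proof.
  intros Hab Hp Hg He Hdist.
  destruct (tcont_on_bounded psi a b Hab Hp) as [B [HB0 HB]].
  assert (Hfar : forall z t, Cmod (z - z0) < eta / 2 -> a <= t <= b ->
    Cmod (gam t - z0) <= 2 * Cmod (gam t - z) /\ eta / 2 <= Cmod (gam t - z)).
  { intros z t Hz Ht. specialize (Hdist t Ht).
    assert (K := Cmod_ge_minus (gam t - z0) (gam t - z)).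
    replace (gam t - z0 - (gam t - z))%C with (z - z0)%C in K by ring. lra. }
  assert (Hne : forall z t, Cmod (z - z0) < eta / 2 -> a <= t <= b -> (gam t - z)%C <> 0%C).
  { intros z t Hz Ht. apply Cmod_gt_0. destruct (Hfar z t Hz Ht). lra. }
  assert (Hne' : forall z t, Cmod (z - z0) < eta / 2 -> a <= t <= b -> gam t <> z).
  { intros z t Hz Ht E. apply (Hne z t Hz Ht). rewrite E. ring. }
  assert (Hz0 : Cmod (z0 - z0) < eta / 2)
    by (replace (z0 - z0)%C with (RtoC 0) by ring; rewrite Cmod_0; lra).
  assert (K1 : forall z, Cmod (z - z0) < eta / 2 ->
    tcont_on (fun t => psi t / (gam t - z))%C a b).
  { intros z Hz t Ht. apply tcont_kernel; [apply Hp|apply Hg|apply Hne']; assumption. }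
  assert (K2 : forall z, Cmod (z - z0) < eta / 2 ->
    tcont_on (fun t => psi t / (gam t - z) / (gam t - z))%C a b).
  { intros z Hz t Ht. apply (tcont_kernel (fun t => psi t / (gam t - z))%C gam);
      [apply K1|apply Hg|apply Hne']; assumption. }
  assert (K3 : forall z, Cmod (z - z0) < eta / 2 ->
    tcont_on (fun t => 2 * (psi t / (gam t - z) / (gam t - z) / (gam t - z)))%C a b).
  { intros z Hz t Ht. apply tcont_mult; [apply tcont_const|].
    apply (tcont_kernel (fun t => psi t / (gam t - z) / (gam t - z))%C gam);
      [apply K2|apply Hg|apply Hne']; assumption. }
  assert (He2 : 0 < eta / 2) by lra.
  assert (H2e : 0 < / eta) by (apply Rinv_0_lt_compat; exact He).
  assert (Hinv : forall t, a <= t <= b -> / Cmod (gam t - z0) <= / eta).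
  { intros t Ht. apply Rinv_le_contravar; [exact He|apply Hdist; exact Ht]. }
  assert (Hinv2 : forall z t, Cmod (z - z0) < eta / 2 -> a <= t <= b ->
    / Cmod (gam t - z) <= 2 * / eta).
  { intros z t Hz Ht. replace (2 * / eta) with (/ (eta / 2)) by (field; lra).
    apply Rinv_le_contravar; [exact He2|apply Hfar; assumption]. }
  split.
  - apply (Cint_param_cder (fun t z => psi t / (gam t - z))%C _ a b z0 (eta / 2)
      (B * (/ eta * / eta * (2 * / eta)))); auto.
    + repeat apply Rmult_le_pos; lra.
    + intros t z Ht Hz.
      assert (N0 := Hne z0 t Hz0 Ht). assert (N := Hne z t Hz Ht).
      replace (psi t / (gam t - z) - psi t / (gam t - z0)
               - psi t / (gam t - z0) / (gam t - z0) * (z - z0))%C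
        with ((psi t * (/ (gam t - z0) * / (gam t - z0) * / (gam t - z)))
              * ((z - z0) * (z - z0)))%C by (field; split; assumption).
      rewrite !Cmod_mult, !Cmod_inv by assumption.
      assert (Q := Hinv t Ht). assert (Q2 := Hinv2 z t Hz Ht).
      assert (P : 0 < / Cmod (gam t - z0)) by (apply Rinv_0_lt_compat, Cmod_gt_0; exact N0).
      assert (P2 : 0 < / Cmod (gam t - z)) by (apply Rinv_0_lt_compat, Cmod_gt_0; exact N).
      assert (Hh := Cmod_ge_0 (z - z0)).
      apply Rmult_le_compat_r; [apply Rmult_le_pos; exact Hh|].
      apply Rmult_le_compat; [apply Cmod_ge_0| |apply HB; exact Ht|].
      { repeat apply Rmult_le_pos; lra. }
      apply Rmult_le_compat; [apply Rmult_le_pos; lra|lra| |exact Q2].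
      apply Rmult_le_compat; lra.
  - exists (Cint (fun t => 2 * (psi t / (gam t - z0) / (gam t - z0) / (gam t - z0)))%C a b).
    apply (Cint_param_cder (fun t z => psi t / (gam t - z) / (gam t - z))%C
      (fun t => 2 * (psi t / (gam t - z0) / (gam t - z0) / (gam t - z0)))%C a b z0 (eta / 2)
      (B * (4 * (/ eta * / eta * ((2 * / eta) * (2 * / eta)))))); auto.
    + repeat apply Rmult_le_pos; lra.
    + intros t z Ht Hz.
      assert (N0 := Hne z0 t Hz0 Ht). assert (N := Hne z t Hz Ht).
      replace (psi t / (gam t - z) / (gam t - z) - psi t / (gam t - z0) / (gam t - z0)
               - 2 * (psi t / (gam t - z0) / (gam t - z0) / (gam t - z0)) * (z - z0))%C
        with ((psi t * (((3 * (gam t - z0) - 2 * (z - z0)) / (gam t - z0)) *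
                (/ (gam t - z0) * / (gam t - z0) * (/ (gam t - z) * / (gam t - z)))))
              * ((z - z0) * (z - z0)))%C by (field; split; assumption).
      assert (Q := Hinv t Ht). assert (Q2 := Hinv2 z t Hz Ht).
      assert (P : 0 < / Cmod (gam t - z0)) by (apply Rinv_0_lt_compat, Cmod_gt_0; exact N0).
      assert (P2 : 0 < / Cmod (gam t - z)) by (apply Rinv_0_lt_compat, Cmod_gt_0; exact N).
      assert (Hh := Cmod_ge_0 (z - z0)).
      (* Here 2 |z - z0| < eta <= |gam t - z0|, so the numerator is at most (3 + 1) |gam t - z0|. *)
      assert (L : Cmod ((3 * (gam t - z0) - 2 * (z - z0)) / (gam t - z0)) <= 4).
      { rewrite Cmod_div by exact N0.
        assert (N0' := proj1 (Cmod_gt_0 _) N0).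
        apply Rmult_le_reg_r with (Cmod (gam t - z0)); [exact N0'|].
        unfold Rdiv. rewrite Rmult_assoc, Rinv_l, Rmult_1_r by lra.
        unfold Cminus at 1. eapply Rle_trans; [apply Cmod_triangle|].
        rewrite Cmod_opp, !Cmod_mult, !Cmod_R, !Rabs_right by lra.
        specialize (Hdist t Ht). lra. }
      rewrite 2!Cmod_mult.
      rewrite (Cmod_mult (z - z0)).
      apply Rmult_le_compat_r; [apply Rmult_le_pos; exact Hh|].
      apply Rmult_le_compat; [apply Cmod_ge_0|apply Cmod_ge_0|apply HB; exact Ht|].
      rewrite Cmod_mult.
      apply Rmult_le_compat; [apply Cmod_ge_0|apply Cmod_ge_0|exact L|].
      rewrite !Cmod_mult, !Cmod_inv by assumption.
      apply Rmult_le_compat; [apply Rmult_le_pos; lra|apply Rmult_le_pos; lra| |];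
        apply Rmult_le_compat; lra.
Qed.

(** Each side has positive distance from z0, namely the distance to the line carrying it, so the
    kernel lemma applies to the four sides. *)
Lemma Rint_kernel_cder (phi : C -> C) (x0 x1 y0 y1 : R) (z0 : C) :
  x0 < Re z0 < x1 -> y0 < Im z0 < y1 -> bdry_cont phi x0 x1 y0 y1 ->
  cder (fun b => Rint (fun z => phi z / (z - b)) x0 x1 y0 y1)%C z0
       (Rint (fun z => phi z / (z - z0) / (z - z0)) x0 x1 y0 y1)%C
  /\ holo (fun b => Rint (fun z => phi z / (z - b) / (z - b)) x0 x1 y0 y1)%C z0.
Proof.
  intros Hx Hy Hc.
  destruct (bdry_cont_sides phi x0 x1 y0 y1 ltac:(lra) ltac:(lra) Hc) as [F1 [F2 [F3 F4]]].
  assert (Dre : forall z, Rabs (Re z - Re z0) <= Cmod (z - z0)).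
  { intros z. assert (K := re_le_Cmod (z - z0)). unfold Cminus in K at 1.
    rewrite re_plus, re_opp in K. exact K. }
  assert (Dim : forall z, Rabs (Im z - Im z0) <= Cmod (z - z0)).
  { intros z. assert (K := im_le_Cmod (z - z0)). unfold Cminus in K at 1.
    rewrite im_plus, im_opp in K. exact K. }
  destruct (Cauchy_kernel_cder (fun t => phi (hline y0 t)) (hline y0) x0 x1 (Im z0 - y0) z0)
    as [A1 B1]; [lra|exact F1|intros t _; apply tcont_hline|lra| |].
  { intros t _. eapply Rle_trans; [|apply Dim]. simpl. rewrite Rabs_left; unfold Im in *; lra. }
  destruct (Cauchy_kernel_cder (fun t => phi (hline y1 t)) (hline y1) x0 x1 (y1 - Im z0) z0)
    as [A2 B2]; [lra|exact F2|intros t _; apply tcont_hline|lra| |].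
  { intros t _. eapply Rle_trans; [|apply Dim]. simpl. rewrite Rabs_right; unfold Im in *; lra. }
  destruct (Cauchy_kernel_cder (fun t => phi (vline x0 t)) (vline x0) y0 y1 (Re z0 - x0) z0)
    as [A3 B3]; [lra|exact F3|intros t _; apply tcont_vline|lra| |].
  { intros t _. eapply Rle_trans; [|apply Dre]. simpl. rewrite Rabs_left; unfold Re in *; lra. }
  destruct (Cauchy_kernel_cder (fun t => phi (vline x1 t)) (vline x1) y0 y1 (x1 - Re z0) z0)
    as [A4 B4]; [lra|exact F4|intros t _; apply tcont_vline|lra| |].
  { intros t _. eapply Rle_trans; [|apply Dre]. simpl. rewrite Rabs_right; unfold Re in *; lra. }
  unfold Rint. split.
  - eapply cder_eq.
    + refine (cder_plus _ _ z0 _ _ (cder_minus _ _ z0 _ _ A1 A2) _).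
      refine (cder_mult (fun _ => Ci) _ z0 _ _ (cder_const Ci z0) (cder_minus _ _ z0 _ _ A4 A3)).
    + cbv beta; ring.
  - refine (holo_plus _ _ z0 (holo_minus _ _ z0 B1 B2) _).
    refine (holo_mult (fun _ => Ci) _ z0 (holo_const Ci z0) (holo_minus _ _ z0 B4 B3)).
Qed.

Lemma square_in_ball (a z : C) (r : R) : 0 < r ->
  box (Re a - r) (Re a + r) (Im a - r) (Im a + r) z -> Cmod (z - a) < 3 * r.
Proof.
  intros Hr [H1 H2]. eapply Rle_lt_trans; [apply Cmod_le_abs|].
  unfold Cminus. rewrite re_plus, im_plus, re_opp, im_opp.
  assert (Rabs (Re z + - Re a) <= r) by (apply Rabs_le; lra).
  assert (Rabs (Im z + - Im a) <= r) by (apply Rabs_le; lra). lra.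
Qed.

Lemma ball_in_square (a z : C) (r : R) : Cmod (z - a) < r ->
  (Re a - r < Re z < Re a + r) /\ (Im a - r < Im z < Im a + r).
Proof.
  intros H.
  assert (K1 := re_le_Cmod (z - a)). assert (K2 := im_le_Cmod (z - a)).
  unfold Cminus in K1 at 1, K2 at 1. rewrite re_plus, re_opp in K1. rewrite im_plus, im_opp in K2.
  apply Rabs_le_between in K1. apply Rabs_le_between in K2. lra.
Qed.

(* Cauchy's formula writes [f] near [a] as a quotient of two Cauchy integrals over a fixed square,
   each of which is twice differentiable; the value [2 i PI] of the denominator is not needed. *)
Theorem holo_derive_holo (f : C -> C) (a : C) (rho : R) : 0 < rho ->
  (forall z, Cmod (z - a) < rho -> holo f z) -> holo (C_derive f) a.
Proof.
  intros Hrho Hf.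
  (* The closed square of half-side r lies in the ball of radius 3 r, where f is differentiable. *)
  set (r := rho / 3). assert (Hr : 0 < r) by (unfold r; lra).
  assert (Hbox : forall z, box (Re a - r) (Re a + r) (Im a - r) (Im a + r) z -> holo f z).
  { intros z Hz. apply Hf. assert (K := square_in_ball a z r Hr Hz). unfold r in K. lra. }
  pose (J := fun g b => Rint (fun z => g z / (z - b))%C (Re a - r) (Re a + r) (Im a - r) (Im a + r)).
  pose (J' := fun g b =>
    Rint (fun z => g z / (z - b) / (z - b))%C (Re a - r) (Re a + r) (Im a - r) (Im a + r)).
  pose (one := fun _ : C => 1%C).
  assert (Ha : Cmod (a - a) < r)
    by (replace (a - a)%C with (RtoC 0) by ring; rewrite Cmod_0; exact Hr).
  assert (HJ : forall g, (forall z, box (Re a - r) (Re a + r) (Im a - r) (Im a + r) z -> holo g z) ->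
    forall b, Cmod (b - a) < r -> cder (J g) b (J' g b) /\ holo (J' g) b).
  { intros g Hg b Hb. destruct (ball_in_square a b r Hb) as [K1 K2].
    refine (Rint_kernel_cder g _ _ _ _ b K1 K2 _).
    intros z [Hz _]. apply holo_ccont. apply Hg. exact Hz. }
  assert (Hone : forall z, box (Re a - r) (Re a + r) (Im a - r) (Im a + r) z -> holo one z)
    by (intros z _; exact (holo_const 1%C z)).
  assert (Hnz : forall b, Cmod (b - a) < r -> J one b <> 0%C).
  { intros b Hb. destruct (ball_in_square a b r Hb) as [K1 K2].
    exact (Rint_inv_nonzero _ _ _ _ b K1 K2). }
  assert (Hq : forall b, Cmod (b - a) < r -> f b = (J f b / J one b)%C).
  { intros b Hb. destruct (ball_in_square a b r Hb) as [K1 K2].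
    unfold J at 1. rewrite (Cauchy_formula f _ _ _ _ b K1 K2 Hbox).
    change (Rint (fun z => 1 / (z - b))%C (Re a - r) (Re a + r) (Im a - r) (Im a + r)) with (J one b).
    assert (Nz := Hnz b Hb). clearbody J. field. exact Nz. }
  assert (Hd : forall b, Cmod (b - a) < r ->
    C_derive f b = (J' f b / J one b + J f b * (J' one b * (- / (J one b * J one b))))%C).
  { intros b Hb. apply (cder_unique f b); [apply holo_C_derive|].
    - apply Hf. unfold r in Hb. lra.
    - apply (cder_ext_near (fun b => J f b * / J one b)%C f b _ (r - Cmod (b - a))); [lra| |].
      + intros y Hy. symmetry. apply Hq.
        replace (y - a)%C with ((y - b) + (b - a))%C by ring.
        eapply Rle_lt_trans; [apply Cmod_triangle|]. lra.
      + refine (cder_mult (J f) (fun b => / J one b)%C b _ _ (proj1 (HJ f Hbox b Hb)) _).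
        exact (cder_comp Cinv (J one) b _ _ (cder_inv _ (Hnz b Hb)) (proj1 (HJ one Hone b Hb))). }
  apply (holo_ext_near _ _ a r Hr (fun y Hy => eq_sym (Hd y Hy))).
  assert (Nz := Hnz a Ha).
  destruct (HJ f Hbox a Ha) as [F1 F2]. destruct (HJ one Hone a Ha) as [O1 O2].
  assert (F3 : holo (J f) a) by (eexists; exact F1).
  assert (O3 : holo (J one) a) by (eexists; exact O1).
  apply (holo_plus (fun y => J' f y / J one y)%C
    (fun y => J f y * (J' one y * (- / (J one y * J one y))))%C).
  - exact (holo_div (J' f) (J one) a F2 O3 Nz).
  - apply (holo_mult (J f) (fun y => J' one y * (- / (J one y * J one y)))%C); [exact F3|].
    apply (holo_mult (J' one) (fun y => - / (J one y * J one y))%C); [exact O2|].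
    apply (holo_ext_near (fun y => 0 - / (J one y * J one y))%C _ a 1 Rlt_0_1).
    { intros y _. clear. clearbody J one. ring. }
    apply (holo_minus (fun _ => 0%C) (fun y => / (J one y * J one y))%C); [apply holo_const|].
    apply (holo_inv (fun y => J one y * J one y)%C).
    + exact (holo_mult (J one) (J one) a O3 O3).
    + apply Cmult_neq_0; exact Nz.
Qed.

(** Removes the singularity of f(z)/z at 0, as needed for z f'/f there. From 1/(z - b) = 1/z + b/(z
    (z - b)) and f(0) = 0, Cauchy's formulas at b and at 0 give f(b) c(b) = b N(b), where c(b) and
    N(b) are the integrals of 1/(z - b) and of (f(z)/z)/(z - b); the quotient is q = N/c. *)
Theorem holo_factor_zero (f : C -> C) (rho : R) : 0 < rho ->
  (forall z, Cmod z < rho -> holo f z) -> f 0%C = 0%C ->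
  exists q r, 0 < r /\ holo q 0%C /\ forall b, Cmod b < r -> f b = (b * q b)%C.
Proof.
  intros Hrho Hf H0.
  set (r := rho / 3). assert (Hr : 0 < r) by (unfold r; lra).
  set (X0 := Re 0%C - r). set (X1 := Re 0%C + r). set (Y0 := Im 0%C - r). set (Y1 := Im 0%C + r).
  assert (Hbox : forall z, box X0 X1 Y0 Y1 z -> holo f z).
  { intros z Hz. apply Hf. assert (K := square_in_ball 0%C z r Hr Hz). unfold r in K.
    replace (z - 0)%C with z in K by ring. lra. }
  assert (Hbd0 : forall z, bdry X0 X1 Y0 Y1 z -> z <> 0%C).
  { intros z [_ Hz] ->. unfold X0, X1, Y0, Y1 in Hz. simpl in Hz. lra. }
  assert (Hphi : bdry_cont (fun z => f z / z)%C X0 X1 Y0 Y1).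
  { intros z Hz. apply holo_ccont. apply (holo_div f (fun z => z)); [|apply holo_id|].
    - apply Hbox. apply Hz.
    - apply Hbd0. exact Hz. }
  pose (N := fun b => Rint (fun z => (f z / z) / (z - b))%C X0 X1 Y0 Y1).
  pose (c := fun b => Rint (fun z => 1 / (z - b))%C X0 X1 Y0 Y1).
  assert (Hin : forall b, Cmod b < r -> (X0 < Re b < X1) /\ (Y0 < Im b < Y1)).
  { intros b Hb. apply ball_in_square. replace (b - 0)%C with b by ring. exact Hb. }
  assert (H0r : Cmod 0%C < r) by (rewrite Cmod_0; exact Hr).
  assert (Hc0 : forall b, Cmod b < r -> c b <> 0%C).
  { intros b Hb. destruct (Hin b Hb) as [K1 K2]. exact (Rint_inv_nonzero _ _ _ _ b K1 K2). }
  exists (fun b => N b / c b)%C, r. split; [exact Hr|]. split.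
  - destruct (Hin 0%C H0r) as [K1 K2]. apply holo_div; [| |apply Hc0; exact H0r].
    + eexists. exact (proj1 (Rint_kernel_cder _ _ _ _ _ 0%C K1 K2 Hphi)).
    + eexists. refine (proj1 (Rint_kernel_cder (fun _ => 1%C) _ _ _ _ 0%C K1 K2 _)).
      intros z _. apply holo_ccont. apply holo_const.
  - intros b Hb. destruct (Hin b Hb) as [K1 K2]. destruct (Hin 0%C H0r) as [L1 L2].
    assert (E := Cauchy_formula f X0 X1 Y0 Y1 b K1 K2 Hbox). fold (c b) in E.
    assert (E0 := Cauchy_formula f X0 X1 Y0 Y1 0%C L1 L2 Hbox). rewrite H0 in E0.
    assert (Hne : forall z, bdry X0 X1 Y0 Y1 z -> (z - b)%C <> 0%C).
    { intros z [_ Hz]. apply Cminus_eq_contra. intros ->. lra. }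
    rewrite (Rint_ext _ (fun z => 1 * (f z / (z - 0)) + b * ((f z / z) / (z - b)))%C) in E.
    + rewrite (Rint_lin 1 b (fun z => f z / (z - 0))%C (fun z => (f z / z) / (z - b))%C) in E.
      * rewrite E0 in E. fold (N b) in E.
        assert (Nz := Hc0 b Hb). transitivity ((f b * c b) / c b)%C; [field; exact Nz|].
        rewrite <- E. field. exact Nz.
      * lra.
      * lra.
      * intros z Hz. apply holo_ccont.
        apply (holo_mult f (fun z => / (z - 0))%C); [apply Hbox, Hz|].
        apply holo_inv_sub. apply Hbd0. exact Hz.
      * intros z Hz. apply holo_ccont.
        apply (holo_mult (fun z => f z / z)%C (fun z => / (z - b))%C).
        -- apply (holo_div f (fun z => z)); [apply Hbox, Hz|apply holo_id|apply Hbd0; exact Hz].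
        -- apply holo_inv_sub. intros ->. apply (Hne b Hz). ring.
    + lra.
    + lra.
    + intros z Hz. assert (Nz := Hne z Hz). assert (Nz0 := Hbd0 z Hz).
      replace (z - 0)%C with z by ring. field. split; assumption.
Qed.

(** * The cardioid and the subordination to [phi_car] *)

Lemma zfpf_0 (f : C -> C) : zfpf f 0%C = 1%C.
Proof. unfold zfpf. destruct (Ceq_dec 0 0); [reflexivity|contradiction]. Qed.

Lemma zfpf_holo (f : C -> C) (z : C) : starlike_base f -> inD z -> holo (zfpf f) z.
Proof.
  intros [[Han [H0 H1]] Hnz] Hz. unfold inD in *.
  assert (Hf : forall y, Cmod y < 1 -> holo f y).
  { intros y Hy. apply ex_derive_C_holo. apply Han. exact Hy. }
  assert (Hf' : forall y, Cmod y < 1 -> holo (C_derive f) y).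
  { intros y Hy. apply (holo_derive_holo f y (1 - Cmod y)); [lra|].
    intros x Hx. apply Hf. replace x with ((x - y) + y)%C by ring.
    eapply Rle_lt_trans; [apply Cmod_triangle|]. lra. }
  destruct (Ceq_dec z 0) as [->|Hz0].
  - destruct (holo_factor_zero f 1 Rlt_0_1 Hf H0) as [q [r [Hr [Hq Hfq]]]].
    assert (Hd0 : C_derive f 0%C = 1%C).
    { apply is_C_derive_unique. exact H1. }
    (* The product rule for f(b) = b q(b) at 0 gives q(0) = f'(0). Thus z f'/f = f'/q extends
       through 0 with the value 1 prescribed in [zfpf]. *)
    assert (Hq0 : q 0%C = 1%C).
    { destruct Hq as [m Hm]. apply is_derive_C_cder in H1.
      apply (cder_unique f 0%C); [|exact H1].
      apply (cder_ext_near (fun b => b * q b)%C f 0%C _ r Hr).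
      - intros y Hy. symmetry. apply Hfq. replace (y - 0)%C with y in Hy by ring. exact Hy.
      - eapply cder_eq; [apply cder_mult; [apply cder_id|exact Hm]|]. cbv beta. ring. }
    apply (holo_ext_near (fun y => C_derive f y / q y)%C _ 0%C (Rmin r 1)).
    + apply Rmin_glb_lt; lra.
    + intros y Hy. replace (y - 0)%C with y in Hy by ring. unfold zfpf.
      destruct (Ceq_dec y 0) as [->|Hy0].
      * rewrite Hd0, Hq0. field.
      * assert (Hyr := Rlt_le_trans _ _ _ Hy (Rmin_l _ _)).
        assert (Hy1 := Rlt_le_trans _ _ _ Hy (Rmin_r _ _)).
        assert (N := Hnz y Hy1 Hy0). rewrite (Hfq y Hyr) in N |- *.
        field. split; [intros E; apply N; rewrite E; ring|exact Hy0].
    + apply holo_div; [apply Hf'; exact Hz|exact Hq|]. rewrite Hq0. exact C1_nz.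
  - apply (holo_ext_near (fun y => y * C_derive f y / f y)%C _ z (Cmod z)).
    + apply Cmod_gt_0. exact Hz0.
    + intros y Hy. unfold zfpf. destruct (Ceq_dec y 0) as [->|_]; [|reflexivity].
      exfalso. rewrite Cmod_minus_sym in Hy. replace (z - 0)%C with z in Hy by ring. lra.
    + apply (holo_div (fun y => y * C_derive f y)%C f).
      * apply (holo_mult (fun y => y) (C_derive f)); [apply holo_id|apply Hf'; exact Hz].
      * apply Hf. exact Hz.
      * apply Hnz; assumption.
Qed.

(* With [G = 2 F - 1], the domain [phi_car(D)] is the interior of the cardioid [r = 2 + 2 cos t] in
   the [G]-plane, the image of [|s - 1| < 1] under [s -> s^2]. *)
Definition cardioid (G : C) : Prop := Cmod G * Cmod G < 2 * Cmod G + 2 * Re G.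

Lemma cardioid_slit (G : C) : cardioid G -> 0 < Cmod G + Re G.
Proof. unfold cardioid. assert (H := Cmod_ge_0 G). nra. Qed.

(** With s = Csqrt G one has |G| = |s|^2 and 2 |G| + 2 Re G = 4 (Re s)^2, so the hypothesis reads
    |s|^2 < 2 Re s. *)
Lemma cardioid_Csqrt (G : C) : cardioid G -> Cmod (Csqrt G - 1) < 1.
Proof.
  intros H. assert (Hs := Csqrt_Re_pos G (cardioid_slit G H)).
  assert (E1 := Re_Csqrt_sqr G). assert (E2 := Cmod_Csqrt G).
  assert (E3 := Cmod_sqr (Csqrt G)).
  assert (E4 := Cmod_sqr (Csqrt G - 1)).
  unfold Cminus in E4 at 3 4 5 6. rewrite re_plus, im_plus, re_opp, im_opp in E4.
  change (Re 1) with 1 in E4. change (Im 1) with 0 in E4.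
  assert (HG := Cmod_ge_0 G). assert (Hd := Cmod_ge_0 (Csqrt G - 1)).
  unfold cardioid in H.
  assert (K : Cmod G < 2 * Re (Csqrt G)) by nra.
  nra.
Qed.

Lemma subord_car (F : C -> C) : (forall z, inD z -> holo F z) -> F 0%C = 1%C ->
  (forall z, inD z -> cardioid (2 * F z - 1)%C) -> subord F phi_car.
Proof.
  intros Hh H0 Hc. exists (fun z => Csqrt (2 * F z - 1) - 1)%C.
  split; [|split; [|split]].
  - intros z Hz. apply ex_derive_C_holo.
    apply (holo_minus (fun z => Csqrt (2 * F z - 1)) (fun _ => 1%C)); [|apply holo_const].
    apply (holo_comp Csqrt (fun z => 2 * F z - 1)%C).
    + apply Csqrt_holo. apply cardioid_slit. apply Hc. exact Hz.
    + apply (holo_minus (fun z => 2 * F z)%C (fun _ => 1%C)); [|apply holo_const].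
      apply (holo_mult (fun _ => 2%C) F); [apply holo_const|apply Hh; exact Hz].
  - intros z Hz. apply cardioid_Csqrt. apply Hc. exact Hz.
  - rewrite H0. replace (2 * 1 - 1)%C with (RtoC 1) by ring. rewrite Csqrt_1. ring.
  - intros z Hz. unfold phi_car.
    assert (E := Csqrt_sqr (2 * F z - 1)).
    transitivity ((Csqrt (2 * F z - 1) * Csqrt (2 * F z - 1) + 1) / 2)%C.
    + rewrite E. field.
    + field.
Qed.

Lemma Sstar_sub_car (psi f : C -> C) : (forall z, inD z -> holo psi z) -> psi 0%C = 1%C ->
  (forall z, inD z -> cardioid (2 * psi z - 1)%C) -> Sstar psi f -> Scar f.
Proof.
  intros Hh H0 Hc [Hb [w [W1 [W2 [W3 W4]]]]].
  destruct (subord_car psi Hh H0 Hc) as [v [V1 [V2 [V3 V4]]]].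
  split; [exact Hb|]. exists (fun z => v (w z)). split; [|split; [|split]].
  - intros z Hz. apply ex_derive_C_holo.
    apply (holo_comp v w); apply ex_derive_C_holo; [apply V1, W2|apply W1]; exact Hz.
  - intros z Hz. apply V2, W2. exact Hz.
  - rewrite W3. exact V3.
  - intros z Hz. rewrite W4 by exact Hz. apply V4. apply W2. exact Hz.
Qed.

(** * Real part and argument of [phi_car] on the disc *)

Lemma inD_sqr (z : C) : inD z -> Re z * Re z + Im z * Im z < 1.
Proof. unfold inD. intros H. rewrite <- Cmod_sqr. assert (K := Cmod_ge_0 z). nra. Qed.

Lemma inD_bounds (z : C) : inD z -> -1 < Re z < 1 /\ -1 < Im z < 1.
Proof. intros H. apply inD_sqr in H. split; nra. Qed.

Lemma Re_phi_car (w : C) :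
  Re (phi_car w) = 1 + Re w + (Re w * Re w - Im w * Im w) / 2.
Proof. unfold phi_car. simpl. unfold Re, Im. field. Qed.

Lemma Im_phi_car (w : C) : Im (phi_car w) = Im w * (1 + Re w).
Proof. unfold phi_car. simpl. unfold Re, Im. field. Qed.

(** With x = Re w, the bound (Im w)^2 < 1 - x^2 gives a real part above 1/2 + x + x^2 = (x + 1/2)^2
    + 1/4. *)
Lemma phi_car_Re_gt (w : C) : inD w -> 1 / 4 < Re (phi_car w).
Proof.
  intros H. apply inD_sqr in H. rewrite Re_phi_car.
  assert (0 <= (Re w + 1 / 2) * (Re w + 1 / 2)) by apply Rle_0_sqr. nra.
Qed.

Lemma phi_car_holo (w : C) : holo phi_car w.
Proof.
  unfold phi_car. apply (holo_plus (fun w => 1 + w)%C (fun w => w * w / 2)%C).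
  - apply (holo_plus (fun _ => 1%C) (fun w => w)); [apply holo_const|apply holo_id].
  - apply (holo_mult (fun w => w * w)%C (fun _ => / 2)%C); [|apply holo_const].
    apply (holo_mult (fun w => w) (fun w => w)); apply holo_id.
Qed.

Lemma phi_car_0 : phi_car 0%C = 1%C.
Proof. unfold phi_car, Cdiv. ring. Qed.

(* The squared bound [27/5] is attained on the circle at [Re w = -1/4]. *)
Lemma phi_car_arg_bound (w : C) : inD w ->
  Im (phi_car w) * Im (phi_car w) < 27 / 5 * (Re (phi_car w) * Re (phi_car w)).
Proof.
  intros H. assert (Hp := phi_car_Re_gt w H).
  assert (Hb := inD_bounds w H). apply inD_sqr in H.
  rewrite Re_phi_car in *. rewrite Im_phi_car.
  set (x := Re w) in *. set (y2 := Im w * Im w) in *.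
  replace (Im w * (1 + x) * (Im w * (1 + x))) with (y2 * ((1 + x) * (1 + x))) by (unfold y2; ring).
  assert (Hy : y2 < 1 - x * x) by lra.
  assert (Hx : 0 < (1 + x) * (1 + x)) by nra.
  assert (A : (1 - x * x) * ((1 + x) * (1 + x)) <= 27 / 5 * ((1 / 2 + x + x * x) * (1 / 2 + x + x * x))).
  (* Twenty times the difference of the two sides is (4x + 1)^2 (8x^2 + 12x + 7), and the second
     factor is 2 (2x + 3/2)^2 + 5/2. *)
  { assert (0 <= ((4 * x + 1) * (4 * x + 1)) * (8 * x * x + 12 * x + 7))
      by (apply Rmult_le_pos; [apply Rle_0_sqr|assert (K := Rle_0_sqr (2 * x + 3 / 2)); unfold Rsqr in K; lra]).
    lra. }
  assert (B : 1 / 2 + x + x * x < 1 + x + (x * x - y2) / 2) by lra.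
  assert (B0 : 0 < 1 / 2 + x + x * x) by nra.
  nra.
Qed.

(** * Inclusions *)

Ltac reim := unfold Cminus; rewrite ?re_plus, ?im_plus, ?re_opp, ?im_opp, ?re_scal_l, ?im_scal_l,
  ?re_plus, ?im_plus, ?re_opp, ?im_opp, ?re_scal_l, ?im_scal_l, ?re_RtoC, ?im_RtoC.

Lemma Cmod_lt_sqr (x y : C) :
  Re x * Re x + Im x * Im x < Re y * Re y + Im y * Im y -> Cmod x < Cmod y.
Proof.
  rewrite <- !Cmod_sqr. assert (H1 := Cmod_ge_0 x). assert (H2 := Cmod_ge_0 y). nra.
Qed.

Lemma Cmod_div_lt_1 (x y : C) : Cmod x < Cmod y -> y <> 0%C /\ Cmod (x / y) < 1.
Proof.
  intros H. assert (Hx := Cmod_ge_0 x).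
  assert (Hy : y <> 0%C) by (apply Cmod_gt_0; lra).
  split; [exact Hy|]. rewrite Cmod_div by exact Hy.
  apply Rmult_lt_reg_r with (Cmod y); [lra|].
  unfold Rdiv. rewrite Rmult_assoc, Rinv_l; lra.
Qed.

Theorem Scar_sub_order (alpha : R) (f : C -> C) :
  0 <= alpha <= 1 / 4 -> Scar f -> Sstar_order alpha f.
Proof.
  intros Ha [Hb [w [_ [W2 [_ W4]]]]]. split; [exact Hb|].
  intros z Hz. rewrite W4 by exact Hz. assert (K := phi_car_Re_gt (w z) (W2 z Hz)). lra.
Qed.

Lemma phi_car_Carg (w : C) : inD w ->
  - atan (3 * sqrt (3 / 5)) < Carg (phi_car w) < atan (3 * sqrt (3 / 5)).
Proof.
  intros H. assert (Hp := phi_car_Re_gt w H). assert (Hb := phi_car_arg_bound w H).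
  rewrite Carg_Re_pos by lra.
  set (u := Re (phi_car w)) in *. set (v := Im (phi_car w)) in *.
  set (t := 3 * sqrt (3 / 5)).
  assert (Ht : t * t = 27 / 5).
  { unfold t. transitivity (9 * (sqrt (3 / 5) * sqrt (3 / 5))); [ring|].
    rewrite sqrt_sqrt; lra. }
  assert (Ht0 : 0 < t) by (unfold t; assert (0 < sqrt (3 / 5)) by (apply sqrt_lt_R0; lra); lra).
  assert (E : v = v / u * u) by (field; lra).
  rewrite <- Ht in Hb. rewrite <- atan_opp.
  split; apply atan_increasing.
  - apply Rmult_lt_reg_r with u; [lra|]. rewrite <- E.
    assert (0 < t * u) by nra. nra.
  - apply Rmult_lt_reg_r with u; [lra|]. rewrite <- E.
    assert (0 < t * u) by nra. nra.
Qed.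

(** P is the power of u with exponent 1/beta. Its argument lies strictly between -PI/2 and PI/2, so
    Re P > 0, which places (P - 1)/(P + 1) in the disc and makes [Clog] undo [Cexp]. *)
Lemma phi_SS_inverse (beta : R) (u : C) : 0 < beta -> 0 < Re u ->
  - (beta * (PI / 2)) < Carg u < beta * (PI / 2) ->
  let P := Cexp (RtoC (/ beta) * Clog u) in
  (P + 1)%C <> 0%C /\ inD ((P - 1) / (P + 1))%C /\ u = phi_SS beta ((P - 1) / (P + 1))%C.
Proof.
  intros Hb Hu Harg P.
  assert (HIm : - (PI / 2) < Im (RtoC (/ beta) * Clog u)%C < PI / 2).
  { rewrite im_scal_l. change (Im (Clog u)) with (Carg u).
    assert (Hib := Rinv_0_lt_compat beta Hb).
    replace (PI / 2) with (/ beta * (beta * (PI / 2))) by (field; lra).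
    split; [rewrite Ropp_mult_distr_r|]; apply Rmult_lt_compat_l; lra. }
  assert (HP : 0 < Re P).
  { unfold P, Cexp. simpl. apply Rmult_lt_0_compat; [apply exp_pos|].
    apply cos_gt_0; [exact (proj1 HIm)|exact (proj2 HIm)]. }
  destruct (Cmod_div_lt_1 (P - 1) (P + 1)) as [N L].
  { apply Cmod_lt_sqr. reim. clearbody P. nra. }
  split; [exact N|]. split; [exact L|].
  unfold phi_SS.
  replace ((1 + (P - 1) / (P + 1)) / (1 - (P - 1) / (P + 1)))%C with P.
  - unfold Cpowr. destruct (Ceq_dec P 0) as [E|_]; [exfalso; exact (Cexp_nz _ E)|].
    unfold P. rewrite Clog_Cexp by exact HIm.
    rewrite Cmult_assoc, <- RtoC_mult, Rinv_r, Cmult_1_l by lra.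
    symmetry. apply Cexp_Clog. exact Hu.
  - clearbody P. field. split; [exact N|].
    replace (P + 1 - (P - 1))%C with (RtoC 2) by ring.
    intros E. apply RtoC_inj in E. lra.
Qed.

Theorem Scar_sub_SS (beta : R) (f : C -> C) :
  beta0 <= beta <= 1 -> Scar f -> SSstar beta f.
Proof.
  intros Hbeta [Hb [w [W1 [W2 [W3 W4]]]]]. split; [exact Hb|].
  assert (HPI := PI_RGT_0).
  assert (Hat : 0 < atan (3 * sqrt (3 / 5))).
  { rewrite <- atan_0. apply atan_increasing.
    assert (0 < sqrt (3 / 5)) by (apply sqrt_lt_R0; lra). lra. }
  assert (E0 : beta0 * (PI / 2) = atan (3 * sqrt (3 / 5))) by (unfold beta0; field; lra).
  assert (Hb0 : 0 < beta) by nra.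
  assert (Hb1 : atan (3 * sqrt (3 / 5)) <= beta * (PI / 2)) by (rewrite <- E0; nra).
  assert (K : forall z, inD z -> let u := phi_car (w z) in
    let P := Cexp (RtoC (/ beta) * Clog u) in
    (P + 1)%C <> 0%C /\ inD ((P - 1) / (P + 1))%C /\ u = phi_SS beta ((P - 1) / (P + 1))%C).
  { intros z Hz. assert (A := phi_car_Carg (w z) (W2 z Hz)).
    apply phi_SS_inverse; [exact Hb0| |lra].
    assert (A2 := phi_car_Re_gt (w z) (W2 z Hz)). lra. }
  pose (P := fun z => Cexp (RtoC (/ beta) * Clog (phi_car (w z)))).
  assert (HP : forall z, inD z -> holo P z).
  { intros z Hz. assert (A2 := phi_car_Re_gt (w z) (W2 z Hz)).
    apply (holo_comp Cexp (fun z => RtoC (/ beta) * Clog (phi_car (w z)))%C).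
    - eexists. apply Cexp_cder.
    - apply (holo_mult (fun _ => RtoC (/ beta)) (fun z => Clog (phi_car (w z)))); [apply holo_const|].
      apply (holo_comp Clog (fun z => phi_car (w z))); [apply Clog_holo; lra|].
      apply (holo_comp phi_car w); [apply phi_car_holo|].
      apply ex_derive_C_holo. apply W1. exact Hz. }
  exists (fun z => (P z - 1) / (P z + 1))%C. split; [|split; [|split]].
  - intros z Hz. apply ex_derive_C_holo.
    apply (holo_div (fun z => P z - 1)%C (fun z => P z + 1)%C).
    + apply (holo_minus P (fun _ => 1%C)); [apply HP; exact Hz|apply holo_const].
    + apply (holo_plus P (fun _ => 1%C)); [apply HP; exact Hz|apply holo_const].
    + apply K. exact Hz.
  - intros z Hz. apply K. exact Hz.
  - unfold P. rewrite W3, phi_car_0, Clog_1, Cmult_0_r, Cexp_0. unfold Cdiv. ring.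
  - intros z Hz. rewrite W4 by exact Hz. apply K. exact Hz.
Qed.

(** Put G = 2F - 1, r = |G|, a = Re G. The hypothesis becomes 25 r^2 + 16 < 9 a^2 + 68 a with a >
    -1, and a <= r then forces r < 4. Outside the cardioid a <= b = (r^2 - 2r)/2; the right side
    increases in a, and inserting b gives a polynomial with the factor r - 4 and a positive
    cofactor, so r > 4. *)
Lemma conic_cardioid (F : C) : Re F > 5 / 3 * Cmod (F - 1) -> cardioid (2 * F - 1).
Proof.
  intros H. unfold cardioid.
  assert (E := Cmod_sqr (F - 1)). assert (E2 := Cmod_sqr (2 * F - 1)).
  assert (L := Re_le_Cmod (2 * F - 1)). assert (L0 := Cmod_ge_0 (2 * F - 1)).
  assert (D0 := Cmod_ge_0 (F - 1)).
  set (d := Cmod (F - 1)) in *. set (r := Cmod (2 * F - 1)) in *.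
  set (a := Re (2 * F - 1)) in *.
  assert (Ea : a = 2 * Re F - 1) by (unfold a; reim; ring).
  assert (E3 : 4 * (d * d) = r * r - 2 * a + 1).
  { rewrite E, E2. fold a. rewrite Ea. reim. ring. }
  assert (Hd : 25 * (4 * (d * d)) < 9 * ((1 + a) * (1 + a))) by nra.
  rewrite E3 in Hd.
  apply Rnot_le_lt. intros Hge.
  assert (Ha1 : -1 < a) by nra.
  assert (Hr4 : r < 4) by nra.
  assert (Hs : (1 + a) <= (r * r - 2 * r) / 2 + 1) by lra.
  assert (Hq : 0 < (r - 4) * (9 / 4 * (r * r * r) + 18 * r + 4)).
  { set (b := (r * r - 2 * r) / 2) in *.
    assert (9 * (a * a) + 68 * a <= 9 * (b * b) + 68 * b) by nra.
    assert (E4 : (r - 4) * (9 / 4 * (r * r * r) + 18 * r + 4)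
      = 9 * (b * b) + 68 * b - 16 - 25 * (r * r)) by (unfold b; field).
    rewrite E4. lra. }
  assert (0 <= r * r * r) by (repeat apply Rmult_le_pos; exact L0).
  nra.
Qed.

Theorem kSstar_sub_Scar (k : R) (f : C -> C) : k >= 5 / 3 -> kSstar k f -> Scar f.
Proof.
  intros Hk [Hb H]. split; [exact Hb|]. apply subord_car.
  - intros z Hz. apply zfpf_holo; assumption.
  - apply zfpf_0.
  - intros z Hz. apply conic_cardioid. specialize (H z Hz).
    assert (K := Cmod_ge_0 (zfpf f z - 1)). nra.
Qed.

(** * The square-root classes *)

(** The half-disc works because |G|^2 <= 2 |G|. It suits images of square roots, which stay in the
    right half-plane and may approach the cusp. *)
Lemma cardioid_disc (G : C) : 0 < Re G -> Cmod G <= 2 -> cardioid G.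
Proof. intros H1 H2. unfold cardioid. assert (H3 := Cmod_ge_0 G). nra. Qed.

Lemma phi_L_holo (alpha : R) (w : C) : inD w -> holo (phi_L alpha) w.
Proof.
  intros H. apply inD_bounds in H. unfold phi_L.
  apply (holo_plus (fun _ => RtoC alpha) (fun w => RtoC (1 - alpha) * Csqrt (1 + w))%C);
    [apply holo_const|].
  apply (holo_mult (fun _ => RtoC (1 - alpha)) (fun w => Csqrt (1 + w))); [apply holo_const|].
  apply (holo_comp Csqrt (fun w => 1 + w)%C).
  - apply Csqrt_holo. assert (K := Cmod_ge_0 (1 + w)). reim. lra.
  - apply (holo_plus (fun _ => 1%C) (fun w => w)); [apply holo_const|apply holo_id].
Qed.

Theorem Sstar_L_sub_Scar (alpha : R) (f : C -> C) :
  1 / 2 <= alpha < 1 -> Sstar_L alpha f -> Scar f.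
Proof.
  intros Ha. apply Sstar_sub_car.
  - intros z. apply phi_L_holo.
  - unfold phi_L. rewrite Cplus_0_r, Csqrt_1, RtoC_minus. ring.
  - intros w Hw. assert (Hb := inD_bounds w Hw).
    set (s := Csqrt (1 + w)).
    assert (Hs : 0 < Re s).
    { apply Csqrt_Re_pos. assert (K := Cmod_ge_0 (1 + w)). reim. lra. }
    assert (Hs2 : Cmod s < 3 / 2).
    { assert (K := Cmod_Csqrt (1 + w)). fold s in K.
      assert (K2 := Cmod_triangle 1 w). rewrite Cmod_1 in K2. unfold inD in Hw.
      assert (K3 := Cmod_ge_0 s). nra. }
    (* For alpha >= 1/2 both coefficients are nonnegative, and with |s| < 3/2 the modulus is at most
       (2 alpha - 1) + 3 (1 - alpha) = 2 - alpha. *)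
    replace (2 * phi_L alpha w - 1)%C with (RtoC (2 * alpha - 1) + RtoC (2 * (1 - alpha)) * s)%C
      by (unfold phi_L; fold s; rewrite !RtoC_minus, !RtoC_mult, !RtoC_minus; ring).
    apply cardioid_disc.
    + reim. nra.
    + eapply Rle_trans; [apply Cmod_triangle|].
      rewrite Cmod_mult, !Cmod_R, !Rabs_right by lra. nra.
Qed.

Lemma sqrt_disc_bounds (Z : C) : Cmod (Z - 1) < 3 / 4 ->
  0 < Cmod Z + Re Z /\ 1 / 2 < Re (Csqrt Z) /\ Cmod (2 * Csqrt Z - 1) <= 2.
Proof.
  intros H.
  assert (E := Cmod_sqr (Z - 1)). assert (EZ := Cmod_sqr Z).
  assert (Hd := Cmod_ge_0 (Z - 1)).
  assert (T := Cmod_ge_minus 1 Z). rewrite Cmod_1, Cmod_minus_sym in T.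
  assert (T2 := Cmod_ge_minus Z 1). rewrite Cmod_1 in T2.
  assert (ER : (Cmod Z * Cmod Z + 7 / 16) / 2 < Re Z).
  { assert (E3 : Cmod (Z - 1) * Cmod (Z - 1) = Cmod Z * Cmod Z - 2 * Re Z + 1)
      by (rewrite E, EZ; reim; ring). nra. }
  assert (S1 := Re_Csqrt_sqr Z). assert (S2 := Cmod_Csqrt Z). assert (S0 := Csqrt_Re_ge Z).
  set (s := Csqrt Z) in *. set (R2 := Cmod Z) in *.
  (* Since |Z| > 1/4, (Re s)^2 = (|Z| + Re Z)/2 exceeds (1/4 + 1/4)/2; the limiting case is Z = 1/4,
     the cusp. *)
  assert (Hp : 1 / 2 < Re s) by nra.
  split; [nra|]. split; [exact Hp|].
  assert (Em : Cmod (2 * s - 1) * Cmod (2 * s - 1) = 4 * R2 - 4 * Re s + 1).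
  { rewrite Cmod_sqr, <- S2, Cmod_sqr. reim. ring. }
  assert (Hr := Cmod_ge_0 (2 * s - 1)).
  (* Equivalent to |2s - 1| <= 2. For |Z| <= 5/4 the bound Re s > 1/2 is enough; for larger |Z| <
     7/4 the squares are compared. *)
  assert (R2 - 3 / 4 <= Re s).
  { destruct (Rle_dec R2 (5 / 4)); nra. }
  nra.
Qed.

Theorem Sstar_sqrt_sub_Scar (c : R) (f : C -> C) :
  0 < c <= 3 / 4 -> Sstar_sqrt c f -> Scar f.
Proof.
  intros Hc.
  assert (K : forall w, inD w -> Cmod ((1 + RtoC c * w) - 1) < 3 / 4).
  { intros w Hw. replace ((1 + RtoC c * w) - 1)%C with (RtoC c * w)%C by ring.
    rewrite Cmod_mult, Cmod_R, Rabs_right by lra. unfold inD in Hw.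
    assert (K := Cmod_ge_0 w). nra. }
  apply Sstar_sub_car.
  - intros w Hw. unfold phi_sqrt. apply (holo_comp Csqrt (fun w => 1 + RtoC c * w)%C).
    + apply Csqrt_holo. apply sqrt_disc_bounds, K, Hw.
    + apply (holo_plus (fun _ => 1%C) (fun w => RtoC c * w)%C); [apply holo_const|].
      apply (holo_mult (fun _ => RtoC c) (fun w => w)); [apply holo_const|apply holo_id].
  - unfold phi_sqrt. rewrite Cmult_0_r, Cplus_0_r. apply Csqrt_1.
  - intros w Hw. destruct (sqrt_disc_bounds _ (K w Hw)) as [_ [H1 H2]].
    apply cardioid_disc; [|exact H2]. unfold phi_sqrt. reim. lra.
Qed.

(** * The linear fractional classes *)

(** The hypothesis is |G|^2 < 4 Re G, and Re G <= |G|. *)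
Lemma cardioid_disc_2 (G : C) : Cmod (G - 2) < 2 -> cardioid G.
Proof.
  intros H. unfold cardioid.
  assert (E := Cmod_sqr (G - 2)). assert (EG := Cmod_sqr G). assert (Hd := Cmod_ge_0 (G - 2)).
  assert (E3 : Cmod (G - 2) * Cmod (G - 2) = Cmod G * Cmod G - 4 * Re G + 4)
    by (rewrite E, EG; reim; ring).
  assert (L := Re_le_Cmod G). nra.
Qed.

Lemma phi_AB_holo (A B : R) (w : C) : (1 + RtoC B * w)%C <> 0%C -> holo (phi_AB A B) w.
Proof.
  intros H. unfold phi_AB.
  assert (K : forall c : R, holo (fun w => 1 + RtoC c * w)%C w).
  { intros c. apply (holo_plus (fun _ => 1%C) (fun w => RtoC c * w)%C); [apply holo_const|].
    apply (holo_mult (fun _ => RtoC c) (fun w => w)); [apply holo_const|apply holo_id]. }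
  apply (holo_div (fun w => 1 + RtoC A * w)%C (fun w => 1 + RtoC B * w)%C); [apply K|apply K|exact H].
Qed.

(* Both sets of hypotheses imply [1/2 <= (1-A)/(1-B)] and [(1+A)/(1+B) <= 5/2]: the image of
   [phi_AB] lies in the disc [|F - 3/2| < 1] inscribed in [phi_car(D)]. *)
Theorem Sstar_AB_sub_Scar (A B : R) (f : C -> C) : -1 < B < A /\ A <= 1 ->
  ((1 - B ^ 2 < 2 * (1 - A * B) <= 3 * (1 - B ^ 2) /\ 2 * A <= 1 + B) \/
   (3 * (1 - B ^ 2) <= 2 * (1 - A * B) < 5 * (1 - B ^ 2) /\ 2 * A <= 3 + 5 * B)) ->
  Sstar_AB A B f -> Scar f.
Proof.
  intros [HAB HA1] Hcase.
  (* The hypotheses locate the centre (1 - AB)/(1 - B^2) of the image disc relative to 3/2 and bound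
     one end of its real diameter; reflection in the centre bounds the other end. *)
  assert (P : 2 * A - B <= 1 /\ 2 * A - 5 * B <= 3).
  { destruct Hcase as [[[_ K1] K2]|[[K1 _] K2]]; split; try lra; simpl in *; nra. }
  destruct P as [P1 P2].
  assert (N : forall w, inD w -> (1 + RtoC B * w)%C <> 0%C).
  { intros w Hw E. apply (f_equal Re) in E. revert E. reim. intros E.
    assert (K := inD_bounds w Hw). nra. }
  apply Sstar_sub_car.
  - intros w Hw. apply phi_AB_holo, N, Hw.
  - unfold phi_AB. rewrite !Cmult_0_r. field.
  - intros w Hw. assert (Nw := N w Hw). assert (Hb := inD_sqr w Hw). apply cardioid_disc_2.
    replace (2 * phi_AB A B w - 1 - 2)%C
      with (2 * ((RtoC (2 * A - 3 * B) * w - 1) / (2 * (1 + RtoC B * w))))%C.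
    2:{ unfold phi_AB. rewrite RtoC_minus, !RtoC_mult. field. exact Nw. }
    rewrite Cmod_mult, Cmod_R, Rabs_right by lra.
    assert (L : Cmod ((RtoC (2 * A - 3 * B) * w - 1) / (2 * (1 + RtoC B * w))) < 1); [|lra].
    apply Cmod_div_lt_1. apply Cmod_lt_sqr. reim.
    set (x := Re w) in *. set (y := Im w) in *.
    set (n := x * x + y * y) in *.
    (* For fixed |w| = s the inequality [Q] is affine in x = Re w, so it suffices to check x = -s
       ([Q1]) and x = s ([Q2]), where it factors. *)
    set (s := sqrt n).
    assert (Hn : 0 <= n) by (unfold n; nra).
    assert (Hs0 : 0 <= s) by apply sqrt_pos.
    assert (Hss : s * s = n) by (apply sqrt_sqrt; exact Hn).
    assert (Hs1 : s < 1) by nra.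
    assert (Hxs : - s <= x <= s) by (unfold n in Hss; split; nra).
    assert (Q1 : ((2 * A - B) * s - 1) * ((2 * A - 5 * B) * s + 3) < 0).
    { assert (0 < 1 - (2 * A - B) * s) by nra.
      assert (0 < (2 * A - 5 * B) * s + 3) by nra. nra. }
    assert (Q2 : ((2 * A - B) * s + 1) * ((2 * A - 5 * B) * s - 3) < 0).
    { assert (0 < 1 + (2 * A - B) * s) by nra.
      assert (0 < 3 - (2 * A - 5 * B) * s) by nra. nra. }
    assert (Q : (2 * A - B) * (2 * A - 5 * B) * n - 2 * (2 * A + B) * x - 3 < 0).
    { rewrite <- Hss. destruct (Rle_dec 0 (2 * A + B)); nra. }
    unfold n in Q. nra.
Qed.

(** The conclusion places phi_car(D) in the disc |F - M| < M, the image of the target function in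
    (viii). The critical m is the larger root of 4m^2 - 6m + 1 = 0, at which the quadratic in Re w
    obtained on |w| = 1 has zero discriminant. *)
Lemma phi_car_disc (M : R) (w : C) : M >= (3 + sqrt 5) / 4 -> inD w ->
  Cmod (phi_car w) * Cmod (phi_car w) < 2 * M * Re (phi_car w).
Proof.
  intros HM Hw. assert (Hp := phi_car_Re_gt w Hw).
  assert (Hb := inD_bounds w Hw). apply inD_sqr in Hw.
  set (m := (3 + sqrt 5) / 4) in *.
  assert (H5 : sqrt 5 * sqrt 5 = 5) by (apply sqrt_sqrt; lra).
  assert (H50 := sqrt_pos 5).
  assert (Hm : 4 * (m * m) = 6 * m - 1) by (unfold m; nra).
  assert (Hm1 : 5 / 4 < m < 4 / 3) by (unfold m; split; nra).
  apply Rlt_le_trans with (2 * m * Re (phi_car w)); [|nra].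
  rewrite Cmod_sqr. rewrite Re_phi_car, Im_phi_car in *.
  set (x := Re w) in *. set (y := Im w) in *.
  set (n := x * x + y * y) in *.
  replace ((1 + x + (x * x - y * y) / 2) * (1 + x + (x * x - y * y) / 2) + y * (1 + x) * (y * (1 + x)))
    with (1 + n * n / 4 + 2 * x + 2 * (x * x) + n * x) by (unfold n; field).
  replace (1 + x + (x * x - y * y) / 2) with (1 + x + x * x - n / 2) by (unfold n; field).
  assert (Hn : 0 <= n) by (unfold n; nra).
  assert (S : 0 <= (m - 5 / 4) + (2 * m - 3) * x + (2 * m - 2) * (x * x)).
  { assert (E : (2 * m - 2) * ((m - 5 / 4) + (2 * m - 3) * x + (2 * m - 2) * (x * x))
      = ((2 * m - 2) * x + (2 * m - 3) / 2) * ((2 * m - 2) * x + (2 * m - 3) / 2)) by nra.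
    assert (0 <= ((2 * m - 2) * x + (2 * m - 3) / 2) * ((2 * m - 2) * x + (2 * m - 3) / 2))
      by apply Rle_0_sqr.
    nra. }
  (* With n = |w|^2, the desired difference is its expression for n = 1, which is [S], plus this
     positive term. *)
  assert (D : 0 < (1 - n) * (m + (1 + n) / 4 + x)) by (apply Rmult_lt_0_compat; lra).
  nra.
Qed.

Theorem Scar_sub_AB (M : R) (f : C -> C) :
  M >= (3 + sqrt 5) / 4 -> Scar f -> Sstar_AB 1 (- ((M - 1) / M)) f.
Proof.
  intros HM [Hb [w [W1 [W2 [W3 W4]]]]]. split; [exact Hb|].
  assert (H50 : 2 < sqrt 5).
  { apply Rsqr_incrst_0; [|lra|apply sqrt_pos]. rewrite Rsqr_sqrt by lra. unfold Rsqr. lra. }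
  assert (HM1 : 5 / 4 < M) by lra.
  set (B := - ((M - 1) / M)).
  assert (HBM : M * (1 + B) = 1) by (unfold B; field; lra).
  assert (HB : -1 < B < 0) by (split; nra).
  assert (K : forall z, inD z -> let F := phi_car (w z) in
    (1 - RtoC B * F)%C <> 0%C /\ inD ((F - 1) / (1 - RtoC B * F))%C
    /\ F = phi_AB 1 B ((F - 1) / (1 - RtoC B * F))%C).
  { intros z Hz F.
    assert (K1 := phi_car_disc M (w z) HM (W2 z Hz)).
    assert (K2 := phi_car_Re_gt (w z) (W2 z Hz)). fold F in K1, K2. clearbody F.
    rewrite Cmod_sqr in K1.
    destruct (Cmod_div_lt_1 (F - 1) (1 - RtoC B * F)) as [N L].
    { apply Cmod_lt_sqr. reim.
      set (u := Re F) in *. set (v := Im F) in *.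
      assert (K3 : (1 + B) * (u * u + v * v) < 2 * u).
      { replace (2 * u) with ((1 + B) * (2 * M * u)) by (transitivity (2 * u * (M * (1 + B))); [ring|rewrite HBM; ring]).
        apply Rmult_lt_compat_l; lra. }
      (* This product equals |1 - B F|^2 - |F - 1|^2. *)
      assert (0 < (1 - B) * (2 * u - (1 + B) * (u * u + v * v))) by (apply Rmult_lt_0_compat; lra).
      nra. }
    split; [exact N|]. split; [exact L|].
    unfold phi_AB. field. split; [exact N|].
    replace (1 - RtoC B * F + RtoC B * (F - 1))%C with (1 - RtoC B)%C by ring.
    intros E. apply (f_equal Re) in E. revert E. reim. lra. }
  exists (fun z => (phi_car (w z) - 1) / (1 - RtoC B * phi_car (w z)))%C.
  split; [|split; [|split]].
  - intros z Hz. apply ex_derive_C_holo.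
    assert (HF : holo (fun z => phi_car (w z)) z).
    { apply (holo_comp phi_car w); [apply phi_car_holo|]. apply ex_derive_C_holo, W1, Hz. }
    apply (holo_div (fun z => phi_car (w z) - 1)%C (fun z => 1 - RtoC B * phi_car (w z))%C).
    + apply (holo_minus (fun z => phi_car (w z)) (fun _ => 1%C)); [exact HF|apply holo_const].
    + apply (holo_minus (fun _ => 1%C) (fun z => RtoC B * phi_car (w z))%C); [apply holo_const|].
      apply (holo_mult (fun _ => RtoC B) (fun z => phi_car (w z))); [apply holo_const|exact HF].
    + apply K. exact Hz.
  - intros z Hz. apply K. exact Hz.
  - rewrite W3, phi_car_0. unfold Cdiv. ring.
  - intros z Hz. rewrite W4 by exact Hz. apply K. exact Hz.
Qed.

(** * The exponential class *)

(** The cardioid is star-shaped about G = 1, the image of the centre w = 0; this reduces (iv) to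
    [alpha0]. Its condition reads |G - 1|^2 - 1 < 2 |G|. With x = |H|^2 and r = Re H, squaring gives
    x^2 - 6x - 3 < 8r, and t times this implies the squared condition for t H. *)
Lemma cardioid_starlike (H : C) (t : R) : 0 < t <= 1 ->
  cardioid (1 + H) -> cardioid (1 + RtoC t * H).
Proof.
  unfold cardioid. intros Ht K.
  assert (E1 := Cmod_sqr (1 + H)). assert (E2 := Cmod_sqr (1 + RtoC t * H)).
  assert (G1 := Cmod_ge_0 (1 + H)). assert (G2 := Cmod_ge_0 (1 + RtoC t * H)).
  revert E1 E2 K. reim.
  set (m := Cmod (1 + H)) in *. set (m' := Cmod (1 + RtoC t * H)) in *.
  set (r := Re H). set (x := r * r + Im H * Im H). intros E1 E2 K.
  assert (Hx : 0 <= x) by (unfold x; nra).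
  assert (E1' : m * m = 1 + 2 * r + x) by (rewrite E1; unfold x; ring).
  assert (E2' : m' * m' = 1 + 2 * t * r + t * t * x) by (rewrite E2; unfold x; ring).
  assert (K' : x - 1 < 2 * m) by lra.
  assert (Goal' : t * t * x - 1 < 2 * m'); [|lra].
  destruct (Rlt_dec (t * t * x) 1) as [L|L]; [lra|].
  assert (Hx1 : 1 <= x).
  { assert (Htt : t * t <= 1) by nra.
    apply Rmult_le_compat_r with (r := x) in Htt; [lra|exact Hx]. }
  assert (Hr : x * x - 6 * x - 3 < 8 * r).
  { assert ((x - 1) * (x - 1) < 2 * m * (2 * m)) by (apply Rmult_le_0_lt_compat; lra). lra. }
  (* The left side is (t^4 x^2 - 6 t^2 x - 3) - t (x^2 - 6x - 3), and its second factor is x^2 t (t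
     - 1)^2 + 3 (t x - 1)^2. *)
  assert (Hq : (t - 1) * (x * x * (t * (t * t + t + 1)) - 6 * x * t + 3) <= 0).
  { assert (0 <= x * x * (t * ((t - 1) * (t - 1))))
      by (apply Rmult_le_pos; [|apply Rmult_le_pos; [lra|]]; apply Rle_0_sqr).
    assert (0 <= (t * x - 1) * (t * x - 1)) by apply Rle_0_sqr.
    assert (0 <= x * x * (t * (t * t + t + 1)) - 6 * x * t + 3) by lra.
    nra. }
  assert (t * (x * x - 6 * x - 3) < t * (8 * r)) by (apply Rmult_lt_compat_l; lra).
  assert ((t * t * x - 1) * (t * t * x - 1) < 4 * (m' * m')) by (rewrite E2'; lra).
  apply Rnot_le_lt. intros Hle.
  assert (2 * m' * (2 * m') <= (t * t * x - 1) * (t * t * x - 1)) by (apply Rmult_le_compat; lra).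
  lra.
Qed.

Lemma cos_ge_quadratic (y : R) : 1 - y * y / 2 <= cos y.
Proof.
  replace y with (2 * (y / 2)) at 3 by field. rewrite cos_2a_sin.
  assert (H : forall z, 0 < z -> sin z * sin z <= z * z).
  { intros z Hz. assert (K1 := sin_lt_x z Hz).
    destruct (Rle_dec 0 (sin z)) as [S|S]; [nra|].
    destruct (Rle_dec 1 z) as [L|L].
    - assert (K3 := SIN_bound z). nra.
    - exfalso. apply S. left. apply sin_gt_0; [exact Hz|]. assert (K3 := PI_RGT_0).
      assert (K4 := PI2_1). lra. }
  assert (H2 : sin (y / 2) * sin (y / 2) <= y / 2 * (y / 2)).
  { destruct (Rtotal_order (y / 2) 0) as [L|[L|L]].
    - specialize (H (- (y / 2)) ltac:(lra)). rewrite sin_neg in H. lra.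
    - rewrite L, sin_0. lra.
    - apply H. exact L. }
  lra.
Qed.

Lemma exp_1_bounds : 2 < exp 1 < 3.
Proof.
  split.
  - assert (K := exp_ineq1 1). lra.
  - assert (K : 5 / 6 < exp (- (1 / 6))) by (assert (L := exp_ineq1 (- (1 / 6))); lra).
    (* The sixth power of 6/5 is 2.985984, just below 3. *)
    assert (K2 : exp (1 / 6) < 6 / 5).
    { rewrite exp_Ropp in K. assert (P := exp_pos (1 / 6)).
      apply Rmult_lt_compat_r with (r := exp (1 / 6)) in K; [|exact P].
      rewrite Rinv_l in K by lra. lra. }
    replace 1 with (1 / 6 + 1 / 6 + (1 / 6 + 1 / 6 + (1 / 6 + 1 / 6))) by field.
    rewrite !exp_plus. assert (P := exp_pos (1 / 6)). set (a := exp (1 / 6)) in *.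
    assert (a * a < 36 / 25) by nra.
    assert (0 < a * a) by nra.
    assert (a * a * (a * a) < 36 / 25 * (36 / 25)) by nra.
    nra.
Qed.

(* The difference of the two sides is concave on [0, 2] because [e^2 < 4 e - 3], vanishes at [0] and
   equals [(e - 1) (3 - e) (e^2 - 1) / e^2] at [2]. *)
Lemma exp_cosh_quadratic (x : R) : 0 < x < 2 ->
  exp x + (4 * exp 1 - 3) * exp (- x) <= 4 * exp 1 - 2 - 2 * exp 1 * x + exp 1 * (x * x).
Proof.
  intros Hx. assert (He := exp_1_bounds).
  assert (He2 : exp 2 = exp 1 * exp 1) by (rewrite <- exp_plus; f_equal; lra).
  set (e := exp 1) in *.
  pose (h := fun x => 4 * e - 2 - 2 * e * x + e * (x * x) - exp x - (4 * e - 3) * exp (- x)).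
  pose (h1 := fun x => - 2 * e + 2 * e * x - exp x + (4 * e - 3) * exp (- x)).
  pose (h2 := fun x => 2 * e - exp x - (4 * e - 3) * exp (- x)).
  assert (D1 : forall x, is_derive h x (h1 x)) by (intros z; unfold h, h1; auto_derive; [exact I|ring]).
  assert (D2 : forall x, is_derive h1 x (h2 x)) by (intros z; unfold h1, h2; auto_derive; [exact I|ring]).
  assert (N2 : forall x, h2 x < 0).
  { intros z. unfold h2. rewrite exp_Ropp. assert (P := exp_pos z). set (X := exp z) in *.
    assert (Q : 0 < ((X - e) * (X - e) + (e - 1) * (3 - e)) / X).
    { apply Rdiv_lt_0_compat; [|exact P]. assert (Q := Rle_0_sqr (X - e)). unfold Rsqr in Q. nra. }
    replace (((X - e) * (X - e) + (e - 1) * (3 - e)) / X) with (X - 2 * e + (4 * e - 3) * / X) in Q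
      by (field; lra). lra. }
  assert (C0 : forall x, continuity_pt h x).
  { intros z. apply derivable_continuous_pt. exists (h1 z). apply is_derive_Reals, D1. }
  assert (C1 : forall x, continuity_pt h1 x).
  { intros z. apply derivable_continuous_pt. exists (h2 z). apply is_derive_Reals, D2. }
  assert (H0 : h 0 = 0) by (unfold h; rewrite Ropp_0, exp_0; ring).
  assert (H2 : 0 < h 2).
  { unfold h. rewrite exp_Ropp, He2.
    replace (4 * e - 2 - 2 * e * 2 + e * (2 * 2) - e * e - (4 * e - 3) * / (e * e))
      with ((e - 1) * (3 - e) * (e * e - 1) / (e * e)) by (field; lra).
    apply Rdiv_lt_0_compat; [|nra].
    apply Rmult_lt_0_compat; [apply Rmult_lt_0_compat|]; nra. }
  assert (Hh : 0 <= h x); [|unfold h in Hh; lra].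
  (* A negative value between the nonnegative end values forces h' to be negative somewhere before x
     and positive somewhere after, against h'' < 0. *)
  apply Rnot_lt_le. intros Hneg.
  destruct (MVT_gen h 0 x h1) as [c1 [B1 M1]]; [intros; apply D1|intros; apply C0|].
  destruct (MVT_gen h x 2 h1) as [c2 [B2 M2]]; [intros; apply D1|intros; apply C0|].
  rewrite Rmin_left, Rmax_right in B1, B2 by lra.
  destruct (MVT_gen h1 c1 c2 h2) as [c3 [_ M3]]; [intros; apply D2|intros; apply C1|].
  assert (A1 : h1 c1 < 0) by nra.
  assert (A2 : 0 < h1 c2) by nra.
  assert (A3 := N2 c3). nra.
Qed.

(** This quotient is 2 phi_e - 1 for alpha = [alpha0]. With m = e - 1, X = exp (1 + Re w) and c =
    cos (Im w), |m G|^2 = X^2 - 2Xc + 1 >= (X - 1)^2. Replacing |m G| by X - 1 on the right and c by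
    its lower bound 1 - x + x^2/2, where x = 1 + Re w, leaves the one-variable inequality
    [exp_cosh_quadratic]. *)
Lemma phi_e_cardioid (w : C) : inD w -> cardioid ((exp 1 * Cexp w - 1) / RtoC (exp 1 - 1)).
Proof.
  intros Hw. assert (Hb := inD_bounds w Hw). apply inD_sqr in Hw.
  assert (He := exp_1_bounds).
  set (G := ((exp 1 * Cexp w - 1) / RtoC (exp 1 - 1))%C).
  set (X := exp (1 + Re w)). set (c := cos (Im w)).
  assert (HX : X = exp 1 * exp (Re w)) by (unfold X; apply exp_plus).
  set (m := exp 1 - 1) in *.
  assert (Hm : 1 < m < 2) by (unfold m; lra).
  assert (EmG : (RtoC m * G)%C = (exp 1 * Cexp w - 1)%C).
  { unfold G. field. intros E. apply RtoC_inj in E. lra. }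
  assert (ER : m * Re G = X * c - 1).
  { rewrite <- re_scal_l, EmG. reim. unfold Cexp. simpl. rewrite HX. unfold c. ring. }
  assert (EI : m * Im G = X * sin (Im w)).
  { rewrite <- im_scal_l, EmG. reim. unfold Cexp. simpl. rewrite HX. ring. }
  assert (Hsc : sin (Im w) * sin (Im w) = 1 - c * c).
  { assert (K := sin2_cos2 (Im w)). unfold Rsqr in K. unfold c. lra. }
  assert (EN : (m * Cmod G) * (m * Cmod G) = X * X - 2 * X * c + 1).
  { transitivity (m * m * (Cmod G * Cmod G)); [ring|]. rewrite Cmod_sqr.
    transitivity ((m * Re G) * (m * Re G) + (m * Im G) * (m * Im G)); [ring|].
    rewrite ER, EI. transitivity ((X * c - 1) * (X * c - 1) + X * X * (sin (Im w) * sin (Im w))); [ring|].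
    rewrite Hsc. ring. }
  assert (Hc1 : c <= 1) by apply COS_bound.
  set (x := 1 + Re w) in *.
  assert (Hcq : 1 - x + x * x / 2 < c).
  { assert (K := cos_ge_quadratic (Im w)). fold c in K. unfold x. nra. }
  assert (HX1 : 1 < X) by (assert (K := exp_ineq1 x); unfold X, x in *; lra).
  assert (HG := Cmod_ge_0 G).
  assert (HL : X - 1 <= m * Cmod G).
  { apply Rnot_lt_le. intros L.
    assert (0 <= m * Cmod G) by (apply Rmult_le_pos; lra).
    assert (m * Cmod G * (m * Cmod G) < (X - 1) * (X - 1)) by (apply Rmult_le_0_lt_compat; lra).
    assert (X * c <= X * 1) by (apply Rmult_le_compat_l; lra). lra. }
  assert (Hx : 0 < x < 2) by (unfold x; lra).
  assert (K := exp_cosh_quadratic x Hx). rewrite exp_Ropp in K.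
  change (exp x) with X in K.
  assert (K2 : X * X + (4 * exp 1 - 3) <= X * (4 * exp 1 - 2 - 2 * exp 1 * x + exp 1 * (x * x))).
  { apply Rmult_le_compat_l with (r := X) in K; [|lra].
    replace (X * (X + (4 * exp 1 - 3) * / X)) with (X * X + (4 * exp 1 - 3)) in K by (field; lra).
    exact K. }
  assert (K3 : X * X - 2 * X * c + 1 < 2 * m * (X - 1) + 2 * m * (X * c - 1)).
  { assert (2 * exp 1 * X * (1 - x + x * x / 2) < 2 * exp 1 * X * c)
      by (apply Rmult_lt_compat_l; nra).
    unfold m. lra. }
  unfold cardioid.
  apply Rmult_lt_reg_l with (m * m); [nra|].
  replace (m * m * (Cmod G * Cmod G)) with ((m * Cmod G) * (m * Cmod G)) by ring.
  replace (m * m * (2 * Cmod G + 2 * Re G)) with (2 * m * (m * Cmod G) + 2 * m * (m * Re G)) by ring.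
  rewrite EN, ER. nra.
Qed.

Theorem Sstar_e_sub_Scar (alpha : R) (f : C -> C) :
  alpha0 <= alpha < 1 -> Sstar_e alpha f -> Scar f.
Proof.
  intros Ha. assert (He := exp_1_bounds). apply Sstar_sub_car.
  - intros w _. unfold phi_e.
    apply (holo_plus (fun _ => RtoC alpha) (fun w => RtoC (1 - alpha) * Cexp w)%C); [apply holo_const|].
    apply (holo_mult (fun _ => RtoC (1 - alpha)) Cexp); [apply holo_const|].
    eexists. apply Cexp_cder.
  - unfold phi_e. rewrite Cexp_0, RtoC_minus. ring.
  - intros w Hw. set (e := exp 1) in *.
    (* t is (1 - alpha)/(1 - alpha0), so 2 phi_e - 1 for alpha lies on the segment from 1 to its
       value for [alpha0]. *)
    set (t := (1 - alpha) * (2 * (e - 1)) / e).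
    assert (Ht : 0 < t <= 1).
    { unfold alpha0 in Ha. fold e in Ha.
      assert (A : (e - 2) <= alpha * (2 * (e - 1))).
      { destruct Ha as [Ha _]. apply Rmult_le_compat_r with (r := 2 * (e - 1)) in Ha; [|lra].
        replace ((e - 2) / (2 * (e - 1)) * (2 * (e - 1))) with (e - 2) in Ha by (field; lra). exact Ha. }
      unfold t. split; [apply Rdiv_lt_0_compat; nra|].
      apply Rmult_le_reg_r with e; [lra|].
      unfold Rdiv. rewrite Rmult_assoc, Rinv_l by lra. lra. }
    set (H := (RtoC (e / (e - 1)) * (Cexp w - 1))%C).
    replace (2 * phi_e alpha w - 1)%C with (1 + RtoC t * H)%C.
    + apply cardioid_starlike; [exact Ht|].
      replace (1 + H)%C with ((exp 1 * Cexp w - 1) / RtoC (exp 1 - 1))%C; [apply phi_e_cardioid; exact Hw|].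
      unfold H. fold e. rewrite RtoC_div, RtoC_minus by lra. field.
      intros E. rewrite <- RtoC_minus in E. apply RtoC_inj in E. lra.
    + unfold H, phi_e.
      transitivity (1 + RtoC (t * (e / (e - 1))) * (Cexp w - 1))%C; [rewrite RtoC_mult; ring|].
      replace (t * (e / (e - 1))) with (2 * (1 - alpha)) by (unfold t; field; lra).
      rewrite RtoC_mult, RtoC_minus. ring.
Qed.

Theorem theorem3p1 :
  (* (i) *)
  (forall alpha : R, 0 <= alpha <= 1/4 ->
     forall f : C -> C, Scar f -> Sstar_order alpha f) /\
  (* (ii) *)
  (forall beta : R, beta0 <= beta <= 1 ->
     forall f : C -> C, Scar f -> SSstar beta f) /\
  (* (iii) *)
  (forall k : R, k >= 5/3 ->
     forall f : C -> C, kSstar k f -> Scar f) /\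
  (* (iv) *)
  (forall alpha : R, alpha0 <= alpha < 1 ->
     forall f : C -> C, Sstar_e alpha f -> Scar f) /\
  (* (v) *)
  (forall alpha : R, 1/2 <= alpha < 1 ->
     forall f : C -> C, Sstar_L alpha f -> Scar f) /\
  (* (vi) *)
  (forall c : R, 0 < c <= 3/4 ->
     forall f : C -> C, Sstar_sqrt c f -> Scar f) /\
  (* (vii) *)
  (forall A B : R, -1 < B < A /\ A <= 1 ->
     ((1 - B^2 < 2 * (1 - A * B) <= 3 * (1 - B^2) /\ 2 * A <= 1 + B) \/
      (3 * (1 - B^2) <= 2 * (1 - A * B) < 5 * (1 - B^2) /\ 2 * A <= 3 + 5 * B)) ->
     forall f : C -> C, Sstar_AB A B f -> Scar f) /\
  (* (viii) *)
  (forall M : R, M >= (3 + sqrt 5) / 4 ->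
     forall f : C -> C, Scar f -> Sstar_AB 1 (- ((M - 1) / M)) f).
Proof.
  split; [|split; [|split; [|split; [|split; [|split; [|split]]]]]].
  - intros alpha Ha f. apply Scar_sub_order. exact Ha.
  - intros beta Hb f. apply Scar_sub_SS. exact Hb.
  - intros k Hk f. apply kSstar_sub_Scar. exact Hk.
  - intros alpha Ha f. apply Sstar_e_sub_Scar. exact Ha.
  - intros alpha Ha f. apply Sstar_L_sub_Scar. exact Ha.
  - intros c Hc f. apply Sstar_sqrt_sub_Scar. exact Hc.
  - intros A B HAB Hcase f. apply Sstar_AB_sub_Scar; assumption.
  - intros M HM f. apply Scar_sub_AB. exact HM.
Qed.
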